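(* Suppose $M$ is a $2n$-dimensional symplectic manifold, with symplectic form $J_{ab}$ and symplectic connection $\nabla_a$. Then there is a natural vector bundle $\mathcal{T}$ on $M$ of rank $2n+2$ equipped with a connection, which is symplectically flat if and only if the curvature $R_{ab}{}^c{}_d$ of $\nabla_a$ has the form $$R_{ab}{}^c{}_d=\delta_a{}^c\Phi_{bd}-\delta_b{}^c\Phi_{ad}+J_{ad}\Phi_{be}J^{ce}-J_{bd}\Phi_{ae}J^{ce}+2J_{ab}\Phi_{de}J^{ce}$$ for some symmetric tensor $\Phi_{ab}$.
   Context: Abstract index notation is used. $J^{ab}$ is the skew inverse of the symplectic form $J_{ab}$, normalised by $J_{ab}J^{ac}=\delta_b{}^c$, where $\delta_b{}^c$ is the canonical pairing between vectors and covectors. A *symplectic connection* is a torsion-free connection $\nabla_a$ on the tangent bundle (hence on all tensor bundles) with $\nabla_aJ_{bc}=0$. Its curvature is defined by $(\nabla_a\nabla_b-\nabla_b\nabla_a)X^c=R_{ab}{}^c{}_dX^d$. ''Natural'' means that the bundle and its connection are canonically constructed from the symplectic form and the symplectic connection. A connection on a vector bundle $E$ is *symplectically flat* if there is an endomorphism $\Theta$ of $E$ with $(\nabla_a\nabla_b-\nabla_b\nabla_a)\Sigma=2J_{ab}\Theta\Sigma$ for all sections $\Sigma$ of $E$ (the commutator being computed with any torsion-free connection on the bundle $\Lambda^1$ of 1-forms). *)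

(* Defs.v *)
(* Smooth manifolds, vector bundles, tensors and connections
   are described by their components with respect to an atlas and to local
   trivialisations. *)
From HB Require Import structures.
From mathcomp Require Import all_boot all_order all_algebra.
From mathcomp Require Import all_classical all_reals all_analysis.

Set Implicit Arguments.
Unset Strict Implicit.
Unset Printing Implicit Defensive.

Import Order.TTheory GRing.Theory Num.Theory.
Import numFieldNormedType.Exports.

Local Open Scope classical_set_scope.
Local Open Scope ring_scope.

Section Smooth.
Context {R : realType} {m : nat} {V : normedModType R}.

Fixpoint Ck (k : nat) (U : set 'rV[R]_m) (f : 'rV[R]_m -> V) : Prop :=
  if k is k'.+1 then
    (forall x, U x -> differentiable f x) /\
    (forall a : 'I_m, Ck k' U (fun x => 'D_(delta_mx 0 a) f x))
  else forall x, U x -> {for x, continuous f}.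

(* Only used with U open, so that the values of f outside U are irrelevant. *)
Definition smooth (U : set 'rV[R]_m) (f : 'rV[R]_m -> V) : Prop :=
  forall k, Ck k U f.

End Smooth.

(* The chart phi i is only meaningful on dom i, its inverse psi i only on
   phi i @` dom i; both are totalised with arbitrary values. *)
Record manifold (R : realType) (m : nat) := Manifold {
  space :> topologicalType;
  chart : Type;
  dom : chart -> set space;
  phi : chart -> space -> 'rV[R]_m;
  psi : chart -> 'rV[R]_m -> space;
  manifold_hausdorff : hausdorff_space space;
  manifold_second_countable : @second_countable space;
  dom_open : forall i, open (dom i);
  dom_cover : forall p, exists i, dom i p;
  phi_open : forall i, open (phi i @` dom i);
  phiK : forall i p, dom i p -> psi i (phi i p) = p;
  phi_continuous : forall i p, dom i p -> {for p, continuous (phi i)};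
  psi_continuous : forall i x, (phi i @` dom i) x -> {for x, continuous (psi i)};
  chart_smooth : forall i j,
    smooth (phi i @` (dom i `&` dom j)) (phi j \o psi i)
}.

Section Manifolds.
Context {R : realType}.

Section OneManifold.
Context {m : nat} (M : manifold R m).

Definition csmooth {V : normedModType R} (W : set M) (g : M -> V) : Prop :=
  forall i : chart M, smooth (phi i @` (W `&` dom i)) (g \o psi i).

(* The partial derivative of g at p along the a-th coordinate of the chart i. *)
Definition dpart {V : normedModType R} (i : chart M) (a : 'I_m) (g : M -> V)
  (p : M) : V := 'D_(delta_mx 0 a) (g \o psi i) (phi i p).

(* Rank r vector bundle given by trivialisations over an open cover:
   a section S has components S k : M -> 'cV_r on vdom k, and
   S l = trans k l *m S k on vdom k `&` vdom l. *)
Record vbundle (r : nat) := VBundle {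
  triv : Type;
  vdom : triv -> set M;
  trans : triv -> triv -> M -> 'M[R]_r
}.

Definition is_vbundle {r} (E : vbundle r) : Prop :=
  [/\ forall k : triv E, open (vdom k),
      forall p, exists k : triv E, vdom k p,
      forall k l : triv E, csmooth (vdom k `&` vdom l) (trans k l),
      forall (k : triv E) p, vdom k p -> trans k k p = 1%:M &
      forall (k l q : triv E) p, vdom k p -> vdom l p -> vdom q p ->
        trans k q p = trans l q p *m trans k l p].

Definition is_section {r} (E : vbundle r) (W : set M)
    (S : triv E -> M -> 'cV[R]_r) : Prop :=
  (forall k, csmooth (W `&` vdom k) (S k)) /\
  (forall k l p, W p -> vdom k p -> vdom l p ->
     S l p = trans k l p *m S k p).

Definition is_endomorphism {r} (E : vbundle r)
    (Theta : triv E -> M -> 'M[R]_r) : Prop :=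
  (forall k, csmooth (vdom k) (Theta k)) /\
  (forall k l p, vdom k p -> vdom l p ->
     Theta l p *m trans k l p = trans k l p *m Theta k p).

(* Matrix-valued connection 1-forms: (A k i p a) is the a-th component, in the
   chart i at the point p, of the connection 1-form in the trivialisation k. *)
Definition conn_form {r} (E : vbundle r) : Type :=
  triv E -> chart M -> M -> 'I_m -> 'M[R]_r.

Definition covd {r} (E : vbundle r) (A : conn_form E)
    (S : triv E -> M -> 'cV[R]_r) (k : triv E) (i : chart M) (a : 'I_m)
    (p : M) : 'cV[R]_r :=
  dpart i a (S k) p + A k i p a *m S k p.

End OneManifold.

Section TwoManifolds.
Context {m m' : nat} {M : manifold R m} {N : manifold R m'}.

Definition smooth_map (f : M -> N) : Prop :=
  continuous f /\
  forall j : chart N, csmooth (f @^-1` dom j) (fun p => phi j (f p)).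

Definition jac (f : M -> N) (i : chart M) (j : chart N) (p : M) : 'M[R]_(m', m) :=
  \matrix_(c, a) dpart i a (fun q => phi j (f q)) p 0 c.

Definition bmap {r r'} (E : vbundle M r) (F : vbundle N r') : Type :=
  triv E -> triv F -> M -> 'M[R]_(r', r).

Definition is_fibrewise_iso {r} (E : vbundle M r) (F : vbundle N r)
    (f : M -> N) (h : bmap E F) : Prop :=
  [/\ forall k l, csmooth (vdom k `&` f @^-1` vdom l) (h k l),
      forall k l p, vdom k p -> vdom l (f p) -> h k l p \in unitmx &
      forall k k' l l' p, vdom k p -> vdom k' p ->
        vdom l (f p) -> vdom l' (f p) ->
        h k' l' p *m trans k k' p = trans l l' (f p) *m h k l p].

(* h \o covd A = covd (f^* B) \o h, written in components. *)
Definition parallel {r r'} (E : vbundle M r) (F : vbundle N r')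
    (A : conn_form E) (B : conn_form F) (f : M -> N) (h : bmap E F) : Prop :=
  forall k l i j a p,
    vdom k p -> dom i p -> vdom l (f p) -> dom j (f p) ->
    dpart i a (h k l) p
      + \sum_d jac f i j p d a *: (B l j (f p) d *m h k l p)
    = h k l p *m A k i p a.

End TwoManifolds.

Section Connections.
Context {m : nat} (M : manifold R m).

Definition tangent : vbundle M m :=
  {| triv := chart M; vdom := fun i => dom i;
     trans := fun i j => jac (id : M -> M) i j |}.

(* With f = id and h = trans, parallel contains both the change of chart
   of a 1-form and the change of trivialisation of a connection. *)
Definition is_connection {r} (E : vbundle M r) (A : conn_form E) : Prop :=
  (forall k i a, csmooth (vdom k `&` dom i) (fun p => A k i p a)) /\
  parallel A A (id : M -> M) (fun k l : triv E => trans k l).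

Definition is_tensor02 (B : chart M -> M -> 'M[R]_m) : Prop :=
  (forall i, csmooth (dom i) (B i)) /\
  (forall i j p, dom i p -> dom j p ->
     B i p = (jac (id : M -> M) i j p)^T *m B j p *m jac (id : M -> M) i j p).

(* Gamma i p a b c is the symbol in
   nabla_a X^c = d_a X^c + \sum_b Gamma_ab^c X^b, in the chart i. *)
Definition christoffel (G : conn_form tangent) (i : chart M) (p : M)
  (a b c : 'I_m) : R := G i i p a c b.

(* nabla_a nabla_b S, the connection G on the tangent bundle being used to
   differentiate the 1-form index b. *)
Definition covd2 (G : conn_form tangent) {r} (E : vbundle M r) (A : conn_form E)
    (S : triv E -> M -> 'cV[R]_r) (k : triv E) (i : chart M) (a b : 'I_m)
    (p : M) : 'cV[R]_r :=
  dpart i a (covd A S k i b) p + A k i p a *m covd A S k i b p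
  - \sum_c christoffel G i p a b c *: covd A S k i c p.

Definition commutator (G : conn_form tangent) {r} (E : vbundle M r)
    (A : conn_form E) (S : triv E -> M -> 'cV[R]_r) (k : triv E) (i : chart M)
    (a b : 'I_m) (p : M) : 'cV[R]_r :=
  covd2 G A S k i a b p - covd2 G A S k i b a p.

End Connections.

Record symplectic (n : nat) := Symplectic {
  base :> manifold R (2 * n);
  J : chart base -> base -> 'M[R]_(2 * n);
  nabla : conn_form (tangent base);
  J_tensor : is_tensor02 J;
  J_skew : forall i p, dom i p -> (J i p)^T = - J i p;
  J_nondegenerate : forall i p, dom i p -> J i p \in unitmx;
  J_closed : forall i p a b c, dom i p ->
    dpart i a (J i) p b c + dpart i b (J i) p c a + dpart i c (J i) p a b = 0;
  nabla_connection : is_connection nabla;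
  nabla_torsion_free : forall i p a b c, dom i p ->
    christoffel nabla i p a b c = christoffel nabla i p b a c;
  nabla_J : forall i p a b c, dom i p ->
    dpart i a (J i) p b c
      - \sum_d christoffel nabla i p a b d * J i p d c
      - \sum_d christoffel nabla i p a c d * J i p b d = 0
}.

Section SymplecticNotions.
Context {n : nat}.

(* J_ab J^ac = delta_b^c reads J^T *m Jup = 1%:M. *)
Definition Jup (M : symplectic n) (i : chart M) (p : M) : 'M[R]_(2 * n) :=
  invmx (J i p)^T.

(* S ranges over the sections over arbitrary open subsets, not only the global
   ones; the commutator being tensorial, this makes no difference. *)
Definition symplectically_flat (M : symplectic n) {r} (E : vbundle M r)
    (A : conn_form E) : Prop :=
  exists Theta : triv E -> M -> 'M[R]_r,
    is_endomorphism Theta /\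
    forall (W : set M) S, open W -> is_section W S ->
    forall k i a b p, W p -> vdom k p -> dom i p ->
      commutator (@nabla n M) A S k i a b p
      = (2 * J i p a b) *: (Theta k p *m S k p).

(* Rm i p a b c d stands for R_ab^c_d in the chart i. *)
Definition is_curvature (M : symplectic n)
    (Rm : chart M -> M -> 'I_(2 * n) -> 'I_(2 * n) -> 'I_(2 * n) -> 'I_(2 * n) -> R)
    : Prop :=
  forall (W : set M) (X : chart M -> M -> 'cV[R]_(2 * n)),
    open W -> @is_section _ M _ (tangent M) W X ->
  forall i a b c p, W p -> dom i p ->
    @commutator _ M (@nabla n M) _ (tangent M) (@nabla n M) X i i a b p c 0
    = \sum_d Rm i p a b c d * X i p d 0.

Definition is_symmetric_tensor (M : symplectic n)
    (Phi : chart M -> M -> 'M[R]_(2 * n)) : Prop :=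
  is_tensor02 Phi /\ forall i p, dom i p -> (Phi i p)^T = Phi i p.

Definition curvature_form (M : symplectic n)
    (Phi : chart M -> M -> 'M[R]_(2 * n)) (i : chart M) (p : M)
    (a b c d : 'I_(2 * n)) : R :=
  let F := Phi i p in let Jd := J i p in let Ju := Jup i p in
  (a == c)%:R * F b d - (b == c)%:R * F a d
  + Jd a d * (\sum_e F b e * Ju c e) - Jd b d * (\sum_e F a e * Ju c e)
  + 2 * Jd a b * (\sum_e F d e * Ju c e).

(* A morphism preserves all the structure. As J is nondegenerate and the
   dimensions agree, it is automatically a local diffeomorphism; inclusions of
   open submanifolds are examples. *)
Definition is_morphism (M N : symplectic n) (f : M -> N) : Prop :=
  [/\ smooth_map f,
      forall i j p, dom i p -> dom j (f p) ->
        J i p = (jac f i j p)^T *m J j (f p) *m jac f i j p &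
      @parallel _ _ M N _ _ (tangent M) (tangent N) (@nabla n M) (@nabla n N)
        f (jac f)].

(* A natural bundle with connection: a functor, covering the identity on
   underlying manifolds, from symplectic manifolds with symplectic connection
   and their (local) isomorphisms to vector bundles with connection and
   connection-preserving fibrewise isomorphisms. The structure is thereby
   also compatible with restriction to open subsets. *)
Definition natural {r} (T : forall M : symplectic n, vbundle M r)
    (A : forall M : symplectic n, conn_form (T M)) : Prop :=
  (forall M, is_vbundle (T M) /\ is_connection (A M)) /\
  exists h : forall (M N : symplectic n), (M -> N) -> bmap (T M) (T N),
    [/\ forall (M N : symplectic n) (f : M -> N), is_morphism f ->
          is_fibrewise_iso f (h M N f) /\ parallel (A M) (A N) f (h M N f),
        forall (M : symplectic n) k l p, vdom k p -> vdom l p ->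
          h M M id k l p = trans k l p &
        forall (M N P : symplectic n) (f : M -> N) (g : N -> P),
          is_morphism f -> is_morphism g ->
          forall k l q p, vdom k p -> vdom l (f p) -> vdom q (g (f p)) ->
          h M P (g \o f) k q p = h N P g l q (f p) *m h M N f k l p].

End SymplecticNotions.
End Manifolds.

Arguments symplectic R n : clear implicits.

(* Main.v *)
(** The bundle is T = R + TM + R with the connection
      D_a (s, X^c, r) = (d_a s + J_ab X^b,
                         nabla_a X^c + delta_a^c r + Phi_a^c s,
                         d_a r - Phi_ab X^b + S_a s),
    where (2n+2) Phi_ab = R_ca^c_b, Phi_a^c = Phi_ae J^ce and
    (2n+1) S_a = - nabla_c Phi_a^c.  The entry TM -> TM of its curvature is
      R_ab^c_d - (delta_a^c Phi_bd - delta_b^c Phi_ad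
                  + J_ad Phi_b^c - J_bd Phi_a^c),
    and the trace over a = c shows that if this is J_ab times an endomorphism,
    then that endomorphism is 2 Phi_d^c, so that R has the required form.
    Conversely, if R has this form, the other entries are multiples of J_ab as
    well: the trace of the TM -> TM entry of the second Bianchi identity of D
    determines the skew part of nabla Phi, and the trace of its entry s -> TM
    determines the skew part of nabla S.

    Naturality rests on the gauge covariance of curvature.  It applies to S as
    well, because S is a trace of the curvature of the connection D with S
    replaced by 0. *)
Require Import Defs.
From mathcomp Require Import all_boot all_order all_algebra.
From mathcomp Require Import all_classical all_reals all_analysis.
From mathcomp Require Import ring.

Set Implicit Arguments.
Unset Strict Implicit.
Unset Printing Implicit Defensive.
Import Order.TTheory GRing.Theory Num.Theory.
Import numFieldNormedType.Exports.
Local Open Scope classical_set_scope.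
Local Open Scope ring_scope.

(** * Smooth functions between open subsets of Euclidean spaces *)

(** The entry r -> s of the curvature of D is 2 J_ab whatever [nabla] is, so a curvature
    proportional to J_ab is the best possible outcome, and the terms of D are chosen towards it.
    Without the term S_a s, the Bianchi identity only brings the entry TM -> r to the shape 2 J_ab
    S_d + J_ad S_b - J_bd S_a; the term S_a s cancels the last two summands. The one entry still
    open, s -> r, is then controlled by the Bianchi identity of the full D.

    Phi and S contain first and second derivatives of the Christoffel symbols, so a direct check of
    their transformation laws would differentiate changes of chart up to four times. Instead, the
    laws of both are traces of one intertwining identity for curvature matrices, in which the
    derivatives of the Jacobian have already cancelled. *)

Section SmoothGeneral.
Context {R : realType} {m : nat} {V : normedModType R}.
Implicit Types (U W : set 'rV[R]_m) (f g : 'rV[R]_m -> V) (k : nat).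

Lemma Ck_subset k U W f : W `<=` U -> Ck k U f -> Ck k W f.
Proof.
move=> WU; elim: k f => [|k IH] f /=; first by move=> h x /WU/h.
by move=> [h1 h2]; split=> [x /WU/h1//|a]; exact/IH.
Qed.

Lemma eq_near_open U f g x : open U -> U x -> (forall y, U y -> f y = g y) ->
  \forall y \near x, f y = g y.
Proof. by move=> oU Ux fg; apply: filterS (open_nbhs_nbhs (conj oU Ux)) => y /fg. Qed.

(** The first-order expansion of [f] at [x] is also one of [g]; [diff_unique] identifies its linear
    part as the differential of [g]. *)
Lemma near_eq_differentiable f g x :
  (\forall y \near x, f y = g y) -> differentiable f x -> differentiable g x.
Proof.
move=> fg df.
have fgx : f x = g x by exact: nbhs_singleton fg.
have dc : continuous ('d f x) by exact: diff_continuous.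
have dE : g \o shift x = cst (g x) + 'd f x +o_ (0 : 'rV[R]_m) id.
  apply/eqaddoP => e e0.
  move/eqaddoP : (diff_locally df) => /(_ e e0) dfe.
  have fg0 : \forall h \near (0 : 'rV[R]_m), f (h + x) = g (h + x).
    by have := fg; rewrite (near_shift 0) /= subr0.
  near=> h; rewrite [X in `|X|](_ : _ =
      (f \o shift x - (cst (f x) + 'd f x)) h); first by near: h.
  by rewrite !fctE /= fgx (near fg0).
by apply/diff_locallyP; rewrite (diff_unique dc dE).
Unshelve. all: by end_near. Qed.

(** An equality on an open set survives differentiation, because it holds near each point of the
    set. *)
Lemma Ck_eq k U f g : open U -> (forall x, U x -> f x = g x) ->
  Ck k U f -> Ck k U g.
Proof.
move=> oU; elim: k f g => [|k IH] f g fg /=.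
  move=> fc x Ux; change (g @ x --> g x); rewrite -(fg _ Ux).
  by apply: cvg_trans (near_eq_cvg (eq_near_open oU Ux fg)) (fc x Ux).
move=> [df dk]; split=> [x Ux|a].
  exact: near_eq_differentiable (eq_near_open oU Ux fg) (df _ Ux).
apply: IH (dk a) => x Ux; apply: near_eq_derive.
exact: eq_near_open oU Ux fg.
Qed.

Lemma CkW k U f : Ck k.+1 U f -> Ck k U f.
Proof.
elim: k f => [|k IH] f; last first.
  by move=> [df dk]; split=> // a; apply: IH.
by move=> [df _] x /df/differentiable_continuous.
Qed.

Lemma smooth_subset U W f : W `<=` U -> smooth U f -> smooth W f.
Proof. by move=> WU sf k; exact: Ck_subset WU (sf k). Qed.

Lemma smooth_eq U f g : open U -> (forall x, U x -> f x = g x) ->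
  smooth U f -> smooth U g.
Proof. by move=> oU fg sf k; exact: Ck_eq oU fg (sf k). Qed.

Lemma smooth_differentiable U f x : smooth U f -> U x -> differentiable f x.
Proof. by move=> /(_ 1%N) [df _] /df. Qed.

Lemma smooth_derive U f a : smooth U f ->
  smooth U (fun x => 'D_(delta_mx 0 a) f x).
Proof. by move=> sf k; have [_] := sf k.+1; apply. Qed.

Lemma smooth_cst U (c : V) : smooth U (fun=> c).
Proof.
move=> k; elim: k c => [|k IH] c; first by move=> x _; exact: cst_continuous.
split=> [x _|a]; first exact: differentiable_cst.
by rewrite [X in Ck _ _ X](_ : _ = fun=> 0) //; apply/funext => x; rewrite derive_cst.
Qed.

(** [Ck] is a condition on the total function [f] at each point of its set separately, so arbitrary
    sets [W] covering [U] suffice. *)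
Lemma smooth_local U f :
  (forall x, U x -> exists2 W, W x & smooth W f) -> smooth U f.
Proof.
move=> sf k; have {sf} : forall x, U x -> exists2 W, W x & Ck k W f.
  by move=> x /sf[W Wx sW]; exists W => //; exact: sW.
elim: k f => [|k IH] f sf; first by move=> x /sf[W Wx]; apply.
split=> [x /sf[W Wx [df _]]|a]; first exact: df.
by apply: IH => x /sf[W Wx [_ dW]]; exists W => //; exact: dW.
Qed.

End SmoothGeneral.

Section SmoothScalar.
Context {R : realType} {m : nat}.
Implicit Types (U W : set 'rV[R]_m) (f g : 'rV[R]_m -> R) (k : nat).
Notation e a := (delta_mx 0 a : 'rV[R]_m).

Lemma derivDE f g v x : differentiable f x -> differentiable g x ->
  'D_v (fun x => f x + g x) x = 'D_v f x + 'D_v g x.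
Proof. by move=> df dg; rewrite -deriveD //; exact: diff_derivable. Qed.

Lemma derivME f g v x : differentiable f x -> differentiable g x ->
  'D_v (fun x => f x * g x) x = 'D_v f x * g x + f x * 'D_v g x.
Proof.
move=> df dg; have -> : (fun x => f x * g x) = f * g by [].
rewrite deriveM //; last 2 first.
- exact: diff_derivable.
- exact: diff_derivable.
by rewrite /GRing.scale /= addrC mulrC.
Qed.

Lemma derivVE f v x : differentiable f x -> f x != 0 ->
  'D_v (fun x => (f x)^-1) x = - ((f x)^-1 * (f x)^-1) * 'D_v f x.
Proof.
move=> df fx0; rewrite deriveV //; last exact: diff_derivable.
by rewrite /GRing.scale /= expr2 invfM.
Qed.

Lemma CkD k U f g : open U -> Ck k U f -> Ck k U g -> Ck k U (fun x => f x + g x).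
Proof.
move=> oU; elim: k f g => [|k IH] f g /=.
  by move=> cf cg x Ux; apply: continuousD; [exact: cf|exact: cg].
move=> [df kf] [dg kg]; split=> [x Ux|a].
  by apply: differentiableD; [exact: df|exact: dg].
apply: (Ck_eq oU) (IH _ _ (kf a) (kg a)) => x Ux.
by rewrite derivDE//; [exact: df|exact: dg].
Qed.

Lemma CkM k U f g : open U -> Ck k U f -> Ck k U g -> Ck k U (fun x => f x * g x).
Proof.
move=> oU; elim: k f g => [|k IH] f g.
  by move=> cf cg x Ux; apply: continuousM; [exact: cf|exact: cg].
move=> Hf Hg; have [df kf] := Hf; have [dg kg] := Hg; split=> [x Ux|a].
  by apply: differentiableM; [exact: df|exact: dg].
apply: (Ck_eq oU) (CkD oU (IH _ _ (kf a) (CkW Hg)) (IH _ _ (CkW Hf) (kg a))).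
by move=> x Ux /=; rewrite derivME//; [exact: df|exact: dg].
Qed.

(** The derivative is - f^-1 f^-1 f', so order [k.+1] reduces to order [k] of f^-1 itself, and [f]
    stays fixed in the induction. *)
Lemma CkV k U f : open U -> (forall x, U x -> f x != 0) ->
  Ck k U f -> Ck k U (fun x => (f x)^-1).
Proof.
move=> oU f0; elim: k => [|k IH].
  by move=> cf x Ux; apply: continuousV; [exact: f0|exact: cf].
move=> Hf; have [df kf] := Hf; split=> [x Ux|a].
  by apply: differentiableV; [exact: df|exact: f0].
have cV := IH (CkW Hf).
apply: (Ck_eq oU) (CkM oU (CkM oU (@smooth_cst R m R U (-1) k) (CkM oU cV cV)) (kf a)).
by move=> x Ux /=; rewrite derivVE ?mulN1r//; [exact: df|exact: f0].
Qed.

Lemma Ck_sum k U I (r : seq I) (P : pred I) (F : I -> 'rV[R]_m -> R) :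
  open U -> (forall i, P i -> Ck k U (F i)) ->
  Ck k U (fun x => \sum_(i <- r | P i) F i x).
Proof.
move=> oU sF; rewrite (_ : (fun x => _) = \sum_(i <- r | P i) F i).
  apply: (big_ind (Ck k U)) => //; first exact: smooth_cst.
  by move=> f g; exact: CkD.
by apply/funext => x; rewrite fct_sumE.
Qed.

Lemma smoothD U f g : open U -> smooth U f -> smooth U g ->
  smooth U (fun x => f x + g x).
Proof. by move=> oU sf sg k; exact: CkD. Qed.

Lemma smoothM U f g : open U -> smooth U f -> smooth U g ->
  smooth U (fun x => f x * g x).
Proof. by move=> oU sf sg k; exact: CkM. Qed.

Lemma smoothV U f : open U -> (forall x, U x -> f x != 0) ->
  smooth U f -> smooth U (fun x => (f x)^-1).
Proof. by move=> oU f0 sf k; exact: CkV. Qed.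

End SmoothScalar.

Section SmoothMatrix.
Context {R : realType} {m : nat} {p q : nat}.
Implicit Types (U : set 'rV[R]_m) (f : 'rV[R]_m -> 'M[R]_(p, q)).

Lemma derive_mx_coord {V : normedModType R} (f : V -> 'M[R]_(p, q)) v x i j :
  differentiable f x -> ('D_v f x) i j = 'D_v (fun y => f y i j) x.
Proof. by move=> df; rewrite derive_mx ?mxE//; exact: diff_derivable. Qed.

Lemma differentiable_mxP {V : normedModType R} (f : V -> 'M[R]_(p, q)) x :
  differentiable f x <-> forall i j, differentiable (fun y => f y i j) x.
Proof.
split=> [df i j|df].
  exact: (differentiable_comp df (differentiable_coord _ i j)).
have -> : f = \sum_i \sum_j (fun y => f y i j *: delta_mx i j).
  apply/funext => y; rewrite fct_sumE [LHS]matrix_sum_delta.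
  by apply: eq_bigr => i _; rewrite fct_sumE.
by apply: differentiable_sum => i; apply: differentiable_sum => j;
  apply: differentiableZl.
Qed.

Lemma continuous_mxP {V : topologicalType} (f : V -> 'M[R]_(p, q)) x :
  {for x, continuous f} <-> forall i j, {for x, continuous (fun y => f y i j)}.
Proof.
split=> [cf i j|cf].
  apply: (@continuous_comp _ _ _ f (fun M : 'M[R]_(p, q) => M i j)) => //.
  exact: coord_continuous.
have -> : f = \sum_i \sum_j (fun y => f y i j *: delta_mx i j).
  apply/funext => y; rewrite fct_sumE [LHS]matrix_sum_delta.
  by apply: eq_bigr => i _; rewrite fct_sumE.
pose P (g : V -> 'M[R]_(p, q)) := {for x, continuous g}.
suff : P (\sum_i \sum_j (fun y => f y i j *: delta_mx i j)) by [].
have P0 : P 0 by exact: cst_continuous.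
have PD g h : P g -> P h -> P (g + h) by exact: continuousD.
apply: (big_ind _ P0 PD) => i _; apply: (big_ind _ P0 PD) => j _.
by apply: continuousZr_tmp; exact: cf.
Qed.

Lemma smooth_mxP U f : open U ->
  smooth U f <-> forall i j, smooth U (fun x => f x i j).
Proof.
move=> oU; split=> [sf i j k|sf k].
  elim: k f {sf}(sf k) => [|k IH] f.
    by move=> cf x /cf /continuous_mxP; apply.
  move=> [df kf]; split=> [x /df /differentiable_mxP|a]; first exact.
  apply: (Ck_eq oU) (IH _ (kf a)) => x Ux /=.
  by rewrite derive_mx_coord//; exact: df.
have {sf}: forall i j, Ck k U (fun x => f x i j) by move=> i j; exact: sf.
elim: k f => [|k IH] f sf.
  by move=> x Ux; apply/continuous_mxP => i j; exact: sf.
have df x : U x -> differentiable f x.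
  by move=> Ux; apply/differentiable_mxP => i j; have [+ _] := sf i j; apply.
split=> // a; apply: IH => i j; have [_ /(_ a)] := sf i j.
by apply: (Ck_eq oU) => x Ux; rewrite derive_mx_coord//; exact: df.
Qed.

End SmoothMatrix.

Section Composition.
Context {R : realType} {m n : nat}.

Lemma derive_comp (F : 'rV[R]_m -> 'rV[R]_n) (g : 'rV[R]_n -> R) x v :
  differentiable F x -> differentiable g (F x) ->
  'D_v (fun y => g (F y)) x =
  \sum_c ('D_v F x) 0 c * 'D_(delta_mx 0 c) g (F x).
Proof.
move=> dF dg; rewrite deriveE; last exact: differentiable_comp.
rewrite (diff_comp dF dg) /= -(deriveE v dF).
rewrite [X in 'd g _ X]row_sum_delta linear_sum; apply: eq_bigr => c _.
by rewrite linearZ /= -deriveE.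
Qed.

(** By the chain rule the partial derivatives are sums of products of a derivative of [F], smooth to
    all orders, with a partial derivative of [g] composed with [F], one order lower; hence the
    induction varies [g] and fixes [F]. *)
Lemma Ck_comp k (U : set 'rV[R]_m) (W : set 'rV[R]_n) (F : 'rV[R]_m -> 'rV[R]_n)
    (g : 'rV[R]_n -> R) :
  open U -> (forall x, U x -> W (F x)) -> smooth U F -> Ck k W g ->
  Ck k U (fun x => g (F x)).
Proof.
move=> oU UW sF; elim: k g => [|k IH] g.
  move=> cg x Ux; apply: (@continuous_comp _ _ _ F g).
    exact: (sF 0%N x Ux).
  exact/cg/UW.
move=> [dg kg]; have dF x : U x -> differentiable F x.
  by move=> Ux; exact: smooth_differentiable sF Ux.
split=> [x Ux|a].
  by apply: (@differentiable_comp _ _ _ _ F g); [exact: dF|exact/dg/UW].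
apply: (@Ck_eq _ _ _ _ _
    (fun x => \sum_c ('D_(delta_mx 0 a) F x) 0 c * 'D_(delta_mx 0 c) g (F x))) => //.
  by move=> x Ux; rewrite derive_comp//; [exact: dF|exact/dg/UW].
apply: Ck_sum => // c _.
apply: CkM => //; last exact: (IH ('D_(delta_mx 0 c) g) (kg c)).
exact: ((smooth_mxP _ oU).1 (smooth_derive _ sF) 0 c k).
Qed.

Lemma smooth_comp (U : set 'rV[R]_m) (W : set 'rV[R]_n) (F : 'rV[R]_m -> 'rV[R]_n)
    (g : 'rV[R]_n -> R) :
  open U -> (forall x, U x -> W (F x)) -> smooth U F -> smooth W g ->
  smooth U (fun x => g (F x)).
Proof. by move=> oU UW sF sg k; exact: Ck_comp UW sF (sg k). Qed.

End Composition.

(** * Symmetry of second derivatives *)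

Section Schwarz.
Context {R : realType} {m : nat}.
Implicit Types (u v x y : 'rV[R]_m) (f : 'rV[R]_m -> R).

Lemma is_derive_line f y u (s : R) : differentiable f (y + s *: u) ->
  is_derive s 1 (fun t : R => f (y + t *: u)) ('D_u f (y + s *: u)).
Proof.
move=> df.
have E : (fun h : R => h^-1 *: (f (y + (h *: 1 + s) *: u) - f (y + s *: u))) =
         (fun h : R => h^-1 *: (f (h *: u + (y + s *: u)) - f (y + s *: u))).
  apply/funext => h; congr (_ *: (f _ - _)).
  by rewrite scalerDl addrCA /GRing.scale /= mulr1.
apply: DeriveDef; last by rewrite /derive /= E.
rewrite /derivable /= E.
exact: diff_derivable.
Qed.

Lemma MVT_line f y u (h : R) : 0 < h ->
  (forall s, 0 <= s <= h -> differentiable f (y + s *: u)) ->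
  exists2 s, 0 <= s <= h & f (y + h *: u) - f y = 'D_u f (y + s *: u) * h.
Proof.
move=> h0 df; have [||s sh] := @MVT R (fun t => f (y + t *: u))
    (fun t => 'D_u f (y + t *: u)) 0 h h0.
- move=> s /itvP sh; apply: is_derive_line; apply: df.
  by rewrite !sh.
- apply: continuous_in_subspaceT => s; rewrite inE /= => /itvP sh.
  have : derivable (fun t : R => f (y + t *: u)) s 1.
    by apply: (@ex_derive _ _ _ _ _ _ _ (is_derive_line _)); apply: df; rewrite !sh.
  by move=> /derivable1_diffP /differentiable_continuous.
- rewrite scale0r addr0 subr0 => E; exists s => //.
  by move/itvP : sh => sh; rewrite !sh.
Qed.

(* Exchanging u and v leaves the left-hand side unchanged: this is the source of
   the symmetry of second derivatives. *)
Lemma double_difference f x u v (h r : R) (U : set 'rV[R]_m) : 0 < h ->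
  h * (`|u| + `|v|) < r -> (forall y, `|y - x| < r -> U y) ->
  (forall y, U y -> differentiable f y) ->
  (forall y, U y -> differentiable ('D_u f) y) ->
  exists2 y, `|y - x| < r &
    f (x + h *: u + h *: v) - f (x + h *: u) - (f (x + h *: v) - f x) =
    'D_v ('D_u f) y * h * h.
Proof.
move=> h0 hr xU df ddf.
have inU s t : 0 <= s <= h -> 0 <= t <= h -> `|x + s *: u + t *: v - x| < r.
  move=> /andP[s0 sh] /andP[t0 th].
  rewrite -(addrA x) [_ - x]addrC addKr (le_lt_trans _ hr)//.
  rewrite (le_trans (ler_normD _ _))// !normrZ !ger0_norm// mulrDr.
  by rewrite lerD// ler_wpM2r.
have h00 : 0 <= (0 : R) <= h by rewrite lexx ltW.
have hh : 0 <= h <= h by rewrite lexx ltW.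
(* The mean value theorem is used twice: along [u] for the [v]-difference [g], then along [v] for
   ['D_u f]. *)
pose g y := f (y + h *: v) - f y.
have dfT y w : differentiable f (y + w) -> differentiable (fun z => f (z + w)) y.
  move=> dfy; apply: (@differentiable_comp _ _ _ _ (fun z => z + w) f); last exact: dfy.
  apply: (@differentiableD _ _ _ id (cst w)); first exact: ex_diff.
  exact: differentiable_cst.
have DfT y w : 'D_u (fun z => f (z + w)) y = 'D_u f (y + w).
  have E : (fun t : R => t^-1 *: (f (t *: u + y + w) - f (y + w))) =
           (fun t : R => t^-1 *: (f (t *: u + (y + w)) - f (y + w))).
    by apply/funext => t; rewrite addrA.
  by rewrite /derive /= E.
have [s sh Es] : exists2 s, 0 <= s <= h &
    g (x + h *: u) - g x = 'D_u g (x + s *: u) * h.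
  apply: MVT_line => // s sh; apply: differentiableB.
    by apply: dfT; apply/df/xU/inU.
  by apply/df/xU; rewrite -[x + _]addr0 -[0](scale0r v); exact: inU.
have {}Es : g (x + h *: u) - g x =
    ('D_u f (x + s *: u + h *: v) - 'D_u f (x + s *: u)) * h.
  rewrite Es; congr (_ * _).
  rewrite (_ : g = (fun y => f (y + h *: v)) - f)//.
  rewrite deriveB ?DfT//; apply: diff_derivable.
    by apply: dfT; apply/df/xU/inU.
  by apply/df/xU; rewrite -[x + _]addr0 -[0](scale0r v); exact: inU.
have [t th Et] := @MVT_line ('D_u f) (x + s *: u) v h h0 (fun t th =>
  ddf _ (xU _ (inU s t sh th))).
exists (x + s *: u + t *: v); first exact: inU.
by rewrite -Et -Es.
Qed.

(** The two orders of differentiation yield different mean value points; continuity of both second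
    derivatives allows these points to tend to [x]. *)
Lemma eq_continuous_arbitrarily_close (A B : 'rV[R]_m -> R) x :
  {for x, continuous A} -> {for x, continuous B} ->
  (forall r : R, 0 < r -> (exists y z,
     [/\ `|y - x| < r, `|z - x| < r & A y = B z])) ->
  A x = B x.
Proof.
move=> cA cB AB; apply/eqP/negP => /negP ne.
pose e := `|A x - B x| / 2.
have e0 : 0 < e by rewrite divr_gt0// normr_gt0 subr_eq0.
move/cvgrPdist_lt : cA => /(_ _ e0) nA.
move/cvgrPdist_lt : cB => /(_ _ e0) nB.
have : \forall y \near x, `|A x - A y| < e /\ `|B x - B y| < e by exact: filterI nA nB.
move=> /nbhs_ballP[r /= r0 xr].
have [y [z [yr zr yz]]] := AB r r0.
have /xr[Ay _] : ball x r y by rewrite -ball_normE /= distrC.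
have /xr[_ Bz] : ball x r z by rewrite -ball_normE /= distrC.
suff : `|A x - B x| < `|A x - B x| by rewrite ltxx.
rewrite [ltRHS]splitr -/e -(subrKA (A y)) (le_lt_trans (ler_normD _ _))//.
by rewrite ltrD// yz distrC.
Qed.

Lemma schwarz f x u v (U : set 'rV[R]_m) : open U -> U x ->
  (forall y, U y -> differentiable f y) ->
  (forall y, U y -> differentiable ('D_u f) y) ->
  (forall y, U y -> differentiable ('D_v f) y) ->
  {for x, continuous ('D_v ('D_u f))} ->
  {for x, continuous ('D_u ('D_v f))} ->
  'D_v ('D_u f) x = 'D_u ('D_v f) x.
Proof.
move=> oU Ux df duf dvf cvu cuv.
apply: (eq_continuous_arbitrarily_close cvu cuv) => e e0.
have /nbhs_ballP[r' /= r'0 xr'] := open_nbhs_nbhs (conj oU Ux).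
pose r := Num.min e r'.
have r0 : 0 < r by rewrite lt_min e0 r'0.
(* The summand 1 keeps the denominator positive when [u] and [v] vanish, and makes the bound [hr]
   strict. *)
pose h := r / (`|u| + `|v| + 1).
have uv0 : 0 < `|u| + `|v| + 1 by rewrite ltr_wpDl// addr_ge0.
have h0 : 0 < h by rewrite divr_gt0.
have hr : h * (`|u| + `|v|) < r.
  by rewrite /h -mulrA gtr_pMr// mulrC ltr_pdivrMr// mul1r ltrDl.
have hr' : h * (`|v| + `|u|) < r by rewrite addrC.
have xU y : `|y - x| < r -> U y.
  by rewrite lt_min => /andP[_ yr]; apply: xr'; rewrite -ball_normE /= distrC.
have [y yr Ey] := double_difference h0 hr xU df duf.
have [z zr Ez] := double_difference h0 hr' xU df dvf.
have re : r <= e by rewrite ge_min lexx.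
exists y, z; split; [exact: lt_le_trans re|exact: lt_le_trans re|].
have E4 (a b c d : R) : a - b - (c - d) = a - c - (b - d) by ring.
have E : f (x + h *: u + h *: v) - f (x + h *: u) - (f (x + h *: v) - f x) =
         f (x + h *: v + h *: u) - f (x + h *: v) - (f (x + h *: u) - f x).
  by rewrite [x + h *: u + h *: v]addrAC; exact: E4.
have {}E := etrans (esym Ey) (etrans E Ez).
by have /(mulIf (lt0r_neq0 h0)) := mulIf (lt0r_neq0 h0) E.
Qed.

Lemma smooth_schwarz f x (U : set 'rV[R]_m) a b : open U -> U x -> smooth U f ->
  'D_(delta_mx 0 a) ('D_(delta_mx 0 b) f) x =
  'D_(delta_mx 0 b) ('D_(delta_mx 0 a) f) x.
Proof.
move=> oU Ux sf; apply: (schwarz oU Ux).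
- by move=> y; exact: smooth_differentiable.
- by move=> y; apply: smooth_differentiable; exact: smooth_derive.
- by move=> y; apply: smooth_differentiable; exact: smooth_derive.
- exact: (smooth_derive a (smooth_derive b sf) 0%N).
- exact: (smooth_derive b (smooth_derive a sf) 0%N).
Qed.

End Schwarz.

(** * Differential calculus in charts *)

Section ManifoldCalculus.
Context {R : realType} {m : nat} (M : manifold R m).
Implicit Types (p q : M) (i j : chart M) (W : set M).

(** An image under [phi i] becomes a preimage under [psi i], whose continuity then gives
    openness. *)
Lemma chart_imageE i W :
  phi i @` (W `&` dom i) = (phi i @` dom i) `&` (psi i @^-1` W).
Proof.
apply/seteqP; split=> x /=.
  by move=> [p [Wp ip] <-]; split; [exists p|rewrite phiK].
by move=> [[p ip <-]]; rewrite phiK// => Wp; exists p.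
Qed.

Lemma chart_image_open i W : open W -> open (phi i @` (W `&` dom i)).
Proof.
move=> oW; rewrite chart_imageE openE => x [[p ip xE] Wx].
have ix : (phi i @` dom i) x by exists p.
apply: filterI.
  by apply: open_nbhs_nbhs; split=> //; exact: phi_open.
apply: (psi_continuous ix); apply: open_nbhs_nbhs.
by split.
Qed.

Lemma chart_image_psi i W x : (phi i @` (W `&` dom i)) x ->
  [/\ W (psi i x), dom i (psi i x) & phi i (psi i x) = x].
Proof. by move=> [p [Wp ip] <-]; rewrite phiK. Qed.

(** Smoothness on a whole neighbourhood and in all charts: this is stable under [dpart], so the
    rules of calculus can be stated at a single point. *)
Definition smooth_at {V : normedModType R} (g : M -> V) p :=
  exists W, [/\ open W, W p & csmooth W g].

Section NormedValues.
Context {V : normedModType R}.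
Implicit Types (f g : M -> V).

Lemma csmooth_at W g p : open W -> csmooth W g -> W p -> smooth_at g p.
Proof. by move=> oW sg Wp; exists W. Qed.

Lemma csmooth_subset W W' g : W' `<=` W -> csmooth W g -> csmooth W' g.
Proof.
move=> sW sg i; apply: smooth_subset (sg i); apply: image_subset => p [/sW].
by split.
Qed.

Lemma csmoothP W g : (forall p, W p -> smooth_at g p) -> csmooth W g.
Proof.
move=> sg i; apply: smooth_local => x [p [Wp ip] <-].
have [W' [oW' W'p sg']] := sg p Wp.
by exists (phi i @` (W' `&` dom i)); [exists p|exact: sg'].
Qed.

Lemma smooth_at_eq f g p W : open W -> W p -> (forall q, W q -> f q = g q) ->
  smooth_at f p -> smooth_at g p.
Proof.
move=> oW Wp fg [W' [oW' W'p sf]]; exists (W `&` W'); split=> //.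
  exact: openI.
move=> i; apply: (@smooth_eq _ _ _ _ (f \o psi i)).
- exact/chart_image_open/openI.
- by move=> x /chart_image_psi[[/fg]].
- by apply: (smooth_subset _ (sf i)); apply: image_subset => q [[_ ?] ?].
Qed.

Lemma dpart_eq i a f g p W : dom i p -> open W -> W p ->
  (forall q, W q -> f q = g q) -> dpart i a f p = dpart i a g p.
Proof.
move=> ip oW Wp fg; apply: near_eq_derive.
apply: (@eq_near_open _ _ _ (phi i @` (W `&` dom i))).
- exact: chart_image_open.
- by exists p.
- by move=> x /chart_image_psi[/fg].
Qed.

Lemma smooth_at_cst (c : V) p : smooth_at (fun=> c) p.
Proof. by exists setT; split=> //; [exact: openT|move=> i; exact: smooth_cst]. Qed.

Lemma smooth_at_differentiable g i p : smooth_at g p -> dom i p ->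
  differentiable (g \o psi i) (phi i p).
Proof.
move=> [W [oW Wp sg]] ip; apply: (smooth_differentiable (sg i)).
by exists p.
Qed.

Lemma dpart_cst i a (c : V) p : dpart i a (fun=> c) p = 0.
Proof. exact: derive_cst. Qed.

End NormedValues.

Section ScalarValues.
Implicit Types (f g : M -> R).

Lemma smooth_at2 (op : R -> R -> R) f g p :
  (forall U (f g : 'rV[R]_m -> R), open U -> smooth U f -> smooth U g ->
    smooth U (fun x => op (f x) (g x))) ->
  smooth_at f p -> smooth_at g p -> smooth_at (fun q => op (f q) (g q)) p.
Proof.
move=> sop [W [oW Wp sf]] [W' [oW' Wp' sg]]; exists (W `&` W').
split=> //; first exact: openI.
move=> i; apply: (sop _ (f \o psi i) (g \o psi i)).
- exact/chart_image_open/openI.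
- by apply: (smooth_subset _ (sf i)); apply: image_subset => q [[? _] ?].
- by apply: (smooth_subset _ (sg i)); apply: image_subset => q [[_ ?] ?].
Qed.

Lemma smooth_atD f g p : smooth_at f p -> smooth_at g p ->
  smooth_at (fun q => f q + g q) p.
Proof. by apply: smooth_at2 => U *; exact: smoothD. Qed.

Lemma smooth_atM f g p : smooth_at f p -> smooth_at g p ->
  smooth_at (fun q => f q * g q) p.
Proof. by apply: smooth_at2 => U *; exact: smoothM. Qed.

Lemma smooth_atN f p : smooth_at f p -> smooth_at (fun q => - f q) p.
Proof.
move=> sf; rewrite (_ : (fun q => _) = (fun q => -1 * f q)).
  by apply: smooth_atM => //; exact: smooth_at_cst.
by apply/funext => q; rewrite mulN1r.
Qed.

Lemma smooth_at_sum I (r : seq I) (P : pred I) (F : I -> M -> R) p :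
  (forall k, P k -> smooth_at (F k) p) ->
  smooth_at (fun q => \sum_(k <- r | P k) F k q) p.
Proof.
move=> sF; rewrite (_ : (fun q => _) = \sum_(k <- r | P k) F k).
  apply: (big_ind (fun g : M -> R => smooth_at g p)) => //.
  - exact: smooth_at_cst.
  - by move=> f g; exact: smooth_atD.
by apply/funext => q; rewrite fct_sumE.
Qed.

Lemma smooth_at_prod I (r : seq I) (P : pred I) (F : I -> M -> R) p :
  (forall k, P k -> smooth_at (F k) p) ->
  smooth_at (fun q => \prod_(k <- r | P k) F k q) p.
Proof.
move=> sF; rewrite (_ : (fun q => _) = \prod_(k <- r | P k) F k).
  apply: (big_ind (fun g : M -> R => smooth_at g p)) => //.
  - exact: smooth_at_cst.
  - by move=> f g; exact: smooth_atM.
by apply/funext => q; rewrite fct_prodE.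
Qed.

Lemma smooth_atV f p W : open W -> W p -> (forall q, W q -> f q != 0) ->
  smooth_at f p -> smooth_at (fun q => (f q)^-1) p.
Proof.
move=> oW Wp f0 [W' [oW' W'p sf]]; exists (W `&` W'); split=> //.
  exact: openI.
move=> i; apply: (@smoothV _ _ _ (f \o psi i)).
- exact/chart_image_open/openI.
- by move=> x /chart_image_psi[[/f0]].
- by apply: (smooth_subset _ (sf i)); apply: image_subset => q [[_ ?] ?].
Qed.

Lemma dpartD i a f g p : dom i p -> smooth_at f p -> smooth_at g p ->
  dpart i a (fun q => f q + g q) p = dpart i a f p + dpart i a g p.
Proof.
move=> ip sf sg.
by apply: (@derivDE _ _ (f \o psi i) (g \o psi i)); exact: smooth_at_differentiable.
Qed.

Lemma dpartM i a f g p : dom i p -> smooth_at f p -> smooth_at g p ->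
  dpart i a (fun q => f q * g q) p = dpart i a f p * g p + f p * dpart i a g p.
Proof.
move=> ip sf sg; rewrite /dpart.
rewrite (@derivME _ _ (f \o psi i) (g \o psi i)) /= ?phiK//.
- exact: smooth_at_differentiable.
- exact: smooth_at_differentiable.
Qed.

Lemma dpartN i a f p : dom i p -> smooth_at f p ->
  dpart i a (fun q => - f q) p = - dpart i a f p.
Proof.
move=> ip sf; rewrite (_ : (fun q => _) = (fun q => -1 * f q)); last first.
  by apply/funext => q; rewrite mulN1r.
rewrite dpartM//; last exact: smooth_at_cst.
by rewrite dpart_cst mul0r add0r mulN1r.
Qed.

Lemma dpart_sum i a I (r : seq I) (F : I -> M -> R) p : dom i p ->
  (forall k, smooth_at (F k) p) ->
  dpart i a (fun q => \sum_(k <- r) F k q) p = \sum_(k <- r) dpart i a (F k) p.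
Proof.
move=> ip sF; elim: r => [|k r IH].
  rewrite big_nil (_ : (fun q => _) = (fun=> 0)) ?dpart_cst//.
  by apply/funext => q; rewrite big_nil.
rewrite big_cons -IH -dpartD//; last exact: smooth_at_sum.
by congr (dpart i a _ p); apply/funext => q; rewrite big_cons.
Qed.

(** Seen in another chart [j], the derivative taken in chart [i] is a smooth function composed with
    the transition map. This makes sense only over [dom i], hence the smaller neighbourhood. *)
Lemma smooth_at_dpart i a g p : dom i p -> smooth_at g p ->
  smooth_at (dpart i a g) p.
Proof.
move=> ip [W [oW Wp sg]]; exists (W `&` dom i); split=> //.
  by apply: openI => //; exact: dom_open.
move=> j; rewrite (_ : _ \o _ = fun x => 'D_(delta_mx 0 a) (g \o psi i)
    ((phi i \o psi j) x))//.
apply: (@smooth_comp _ _ _ _ (phi i @` (W `&` dom i)) (phi i \o psi j)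
  ('D_(delta_mx 0 a) (g \o psi i))).
- by apply: chart_image_open; apply: openI => //; exact: dom_open.
- by move=> x /chart_image_psi[[Wx ix] jx _] /=; exists (psi j x).
- apply: (smooth_subset _ (chart_smooth j i)); apply: image_subset.
  by move=> q [[_ ?] ?].
- exact: smooth_derive.
Qed.

Lemma dpart_schwarz i a b g p : dom i p -> smooth_at g p ->
  dpart i a (dpart i b g) p = dpart i b (dpart i a g) p.
Proof.
move=> ip [W [oW Wp sg]].
have oU := @chart_image_open i _ oW.
have Up : (phi i @` (W `&` dom i)) (phi i p) by exists p.
have E c : \forall x \near phi i p, (dpart i c g \o psi i) x =
    'D_(delta_mx 0 c) (g \o psi i) x.
  apply: (eq_near_open oU Up) => x /chart_image_psi[_ _ xE].
  by rewrite /= /dpart xE.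
rewrite /dpart (near_eq_derive _ (E b)) (near_eq_derive _ (E a)).
exact: smooth_schwarz oU Up (sg i).
Qed.

End ScalarValues.

Section MatrixValues.
Context {r s : nat}.
Implicit Types (f g : M -> 'M[R]_(r, s)).

Lemma smooth_at_mxP f p :
  smooth_at f p <-> forall u v, smooth_at (fun q => f q u v) p.
Proof.
split=> [[W [oW Wp sf]] u v|sf].
  exists W; split=> // i.
  exact: ((smooth_mxP _ (@chart_image_open i _ oW)).1 (sf i)).
have /choice[W HW] : forall w : 'I_r * 'I_s, exists W, [/\ open W, W p &
    csmooth W (fun q => f q w.1 w.2)] by move=> w; exact: sf.
(* There are finitely many entries, so their neighbourhoods intersect in a neighbourhood, whose
   interior is the open set sought. *)
have nW : nbhs p [set q | forall w, W w q].
  apply: filter_forall => w; have [oW Wp _] := HW w.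
  exact: open_nbhs_nbhs.
exists ([set q | forall w, W w q]^°); split => [|//|i].
  exact: open_interior.
apply/smooth_mxP; first exact/chart_image_open/open_interior.
move=> u v; have [_ _ sW] := HW (u, v).
apply: (csmooth_subset _ sW) => q /interior_subset; exact.
Qed.

Lemma dpart_mxE i a f p u v : dom i p -> smooth_at f p ->
  dpart i a f p u v = dpart i a (fun q => f q u v) p.
Proof. by move=> ip sf; exact: derive_mx_coord (smooth_at_differentiable sf ip). Qed.

#[local] Opaque dpart.

Lemma smooth_at_coord f p u v : smooth_at f p -> smooth_at (fun q => f q u v) p.
Proof. by move/smooth_at_mxP. Qed.

Lemma smooth_mxD f g p : smooth_at f p -> smooth_at g p ->
  smooth_at (fun q => f q + g q) p.
Proof.
move=> sf sg; apply/smooth_at_mxP => u v.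
under [X in smooth_at X]funext do rewrite mxE.
by apply: smooth_atD; exact: smooth_at_coord.
Qed.

Lemma smooth_mxN f p : smooth_at f p -> smooth_at (fun q => - f q) p.
Proof.
move=> sf; apply/smooth_at_mxP => u v.
under [X in smooth_at X]funext do rewrite mxE.
by apply: smooth_atN; exact: smooth_at_coord.
Qed.

Lemma smooth_mxZ (c : M -> R) f p : smooth_at c p -> smooth_at f p ->
  smooth_at (fun q => c q *: f q) p.
Proof.
move=> sc sf; apply/smooth_at_mxP => u v.
under [X in smooth_at X]funext do rewrite mxE.
by apply: smooth_atM => //; exact: smooth_at_coord.
Qed.

Lemma smooth_mx_sum I (rr : seq I) (P : pred I) (F : I -> M -> 'M[R]_(r, s)) p :
  (forall k, P k -> smooth_at (F k) p) ->
  smooth_at (fun q => \sum_(k <- rr | P k) F k q) p.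
Proof.
move=> sF; apply/smooth_at_mxP => u v.
under [X in smooth_at X]funext do rewrite summxE.
by apply: smooth_at_sum => k Pk; apply/smooth_at_coord/sF.
Qed.

Lemma smooth_mx_dpart i a f p : dom i p -> smooth_at f p ->
  smooth_at (dpart i a f) p.
Proof.
move=> ip sf; apply/smooth_at_mxP => u v.
have [W [oW Wp sW]] := sf.
apply: (@smooth_at_eq _ (dpart i a (fun q => f q u v)) _ _ (W `&` dom i)).
- by apply: openI => //; exact: dom_open.
- by split.
- by move=> q [Wq iq]; rewrite dpart_mxE//; exact: csmooth_at sW Wq.
- exact/smooth_at_dpart/smooth_at_coord.
Qed.

Lemma dpart_mx_schwarz i a b f p : dom i p -> smooth_at f p ->
  dpart i a (dpart i b f) p = dpart i b (dpart i a f) p.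
Proof.
move=> ip sf; apply/matrixP => u v.
have E c d : dpart i d (dpart i c f) p u v =
    dpart i d (dpart i c (fun q => f q u v)) p.
  rewrite dpart_mxE//; last exact: smooth_mx_dpart.
  have [W [oW Wp sW]] := sf; apply: (@dpart_eq _ _ _ _ _ _ (W `&` dom i)) => //.
    by apply: openI => //; exact: dom_open.
  by move=> q [Wq iq]; rewrite dpart_mxE//; exact: csmooth_at sW Wq.
apply: etrans (E b a) (etrans _ (esym (E a b))).
by apply: dpart_schwarz => //; exact: smooth_at_coord.
Qed.

Lemma dpart_mxD i a f g p : dom i p -> smooth_at f p -> smooth_at g p ->
  dpart i a (fun q => f q + g q) p = dpart i a f p + dpart i a g p.
Proof.
move=> ip sf sg; apply/matrixP => u v; rewrite mxE !dpart_mxE//; last exact: smooth_mxD.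
rewrite -dpartD//; try exact: smooth_at_coord.
by congr (dpart i a _ p); apply/funext => q; rewrite mxE.
Qed.

Lemma dpart_mxN i a f p : dom i p -> smooth_at f p ->
  dpart i a (fun q => - f q) p = - dpart i a f p.
Proof.
move=> ip sf; apply/matrixP => u v; rewrite mxE !dpart_mxE//; last exact: smooth_mxN.
rewrite -dpartN//; try exact: smooth_at_coord.
by congr (dpart i a _ p); apply/funext => q; rewrite mxE.
Qed.

Lemma dpart_mxZ i a (c : M -> R) f p : dom i p -> smooth_at c p -> smooth_at f p ->
  dpart i a (fun q => c q *: f q) p = dpart i a c p *: f p + c p *: dpart i a f p.
Proof.
move=> ip sc sf; apply/matrixP => u v; rewrite !mxE !dpart_mxE//; last exact: smooth_mxZ.
rewrite -dpartM//; try exact: smooth_at_coord.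
by congr (dpart i a _ p); apply/funext => q; rewrite mxE.
Qed.

Lemma dpart_mx_sum i a I (rr : seq I) (F : I -> M -> 'M[R]_(r, s)) p : dom i p ->
  (forall k, smooth_at (F k) p) ->
  dpart i a (fun q => \sum_(k <- rr) F k q) p = \sum_(k <- rr) dpart i a (F k) p.
Proof.
move=> ip sF; apply/matrixP => u v; rewrite summxE dpart_mxE//; last first.
  by apply: smooth_mx_sum.
under [RHS]eq_bigr do rewrite dpart_mxE//.
rewrite -dpart_sum//; last by move=> k; exact: smooth_at_coord.
by congr (dpart i a _ p); apply/funext => q; rewrite summxE.
Qed.

End MatrixValues.

Lemma smooth_mxT {r s} (f : M -> 'M[R]_(r, s)) p :
  smooth_at f p -> smooth_at (fun q => (f q)^T) p.
Proof.
move=> sf; apply/smooth_at_mxP => u v.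
under [X in smooth_at X]funext do rewrite mxE.
exact: smooth_at_coord.
Qed.

Lemma dpart_mxT {r s} i a (f : M -> 'M[R]_(r, s)) p : dom i p -> smooth_at f p ->
  dpart i a (fun q => (f q)^T) p = (dpart i a f p)^T.
Proof.
move=> ip sf; apply/matrixP => u v; rewrite mxE !dpart_mxE//; last exact: smooth_mxT.
by congr (dpart i a _ p); apply/funext => q; rewrite mxE.
Qed.

Lemma smooth_mxM {r s t} (f : M -> 'M[R]_(r, s)) (g : M -> 'M[R]_(s, t)) p :
  smooth_at f p -> smooth_at g p -> smooth_at (fun q => f q *m g q) p.
Proof.
move=> sf sg; apply/smooth_at_mxP => u v.
under [X in smooth_at X]funext do rewrite mxE.
by apply: smooth_at_sum => k _; apply: smooth_atM; exact: smooth_at_coord.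
Qed.

Lemma dpart_mxM {r s t} i a (f : M -> 'M[R]_(r, s)) (g : M -> 'M[R]_(s, t)) p :
  dom i p -> smooth_at f p -> smooth_at g p ->
  dpart i a (fun q => f q *m g q) p = dpart i a f p *m g p + f p *m dpart i a g p.
Proof.
move=> ip sf sg; apply/matrixP => u v; rewrite !mxE dpart_mxE//; last exact: smooth_mxM.
rewrite (_ : (fun q => _) = (fun q => \sum_k f q u k * g q k v)); last first.
  by apply/funext => q; rewrite mxE.
rewrite dpart_sum// => [|k]; last by apply: smooth_atM; exact: smooth_at_coord.
rewrite -big_split; apply: eq_bigr => k _ /=.
by rewrite dpartM// ?dpart_mxE//; exact: smooth_at_coord.
Qed.

Lemma smooth_at_row {r s} (f : M -> 'M[R]_(r, s)) a p :
  smooth_at f p -> smooth_at (fun q => row a (f q)) p.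
Proof.
move=> sf; apply/smooth_at_mxP => u v.
under [X in smooth_at X]funext do rewrite mxE.
exact: smooth_at_coord.
Qed.

Lemma smooth_at_col {r s} (f : M -> 'M[R]_(r, s)) a p :
  smooth_at f p -> smooth_at (fun q => col a (f q)) p.
Proof.
move=> sf; apply/smooth_at_mxP => u v.
under [X in smooth_at X]funext do rewrite mxE.
exact: smooth_at_coord.
Qed.

Lemma smooth_at_row_mx {r s t} (f : M -> 'M[R]_(r, s)) (g : M -> 'M[R]_(r, t)) p :
  smooth_at f p -> smooth_at g p -> smooth_at (fun q => row_mx (f q) (g q)) p.
Proof.
move=> sf sg; apply/smooth_at_mxP => u v.
under [X in smooth_at X]funext do rewrite mxE.
by case: (fintype.split v) => w; exact: smooth_at_coord.
Qed.

Lemma smooth_at_col_mx {r s t} (f : M -> 'M[R]_(r, s)) (g : M -> 'M[R]_(t, s)) p :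
  smooth_at f p -> smooth_at g p -> smooth_at (fun q => col_mx (f q) (g q)) p.
Proof.
move=> sf sg; apply/smooth_at_mxP => u v.
under [X in smooth_at X]funext do rewrite mxE.
by case: (fintype.split u) => w; exact: smooth_at_coord.
Qed.

Lemma smooth_at_block_mx {r s t u} (A : M -> 'M[R]_(r, s)) (B : M -> 'M[R]_(r, t))
    (C : M -> 'M[R]_(u, s)) (D : M -> 'M[R]_(u, t)) p :
  smooth_at A p -> smooth_at B p -> smooth_at C p -> smooth_at D p ->
  smooth_at (fun q => block_mx (A q) (B q) (C q) (D q)) p.
Proof. by move=> *; apply: smooth_at_col_mx; exact: smooth_at_row_mx. Qed.

Lemma dpart_row_mx {r s t} i a (f : M -> 'M[R]_(r, s)) (g : M -> 'M[R]_(r, t)) p :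
  dom i p -> smooth_at f p -> smooth_at g p ->
  dpart i a (fun q => row_mx (f q) (g q)) p = row_mx (dpart i a f p) (dpart i a g p).
Proof.
move=> ip sf sg; apply/matrixP => u v; rewrite dpart_mxE//; last exact: smooth_at_row_mx.
case: (split_ordP v) => w ->; rewrite ?row_mxEl ?row_mxEr dpart_mxE//.
  by congr (dpart i a _ p); apply/funext => q; rewrite row_mxEl.
by congr (dpart i a _ p); apply/funext => q; rewrite row_mxEr.
Qed.

Lemma dpart_col_mx {r s t} i a (f : M -> 'M[R]_(r, s)) (g : M -> 'M[R]_(t, s)) p :
  dom i p -> smooth_at f p -> smooth_at g p ->
  dpart i a (fun q => col_mx (f q) (g q)) p = col_mx (dpart i a f p) (dpart i a g p).
Proof.
move=> ip sf sg; apply/matrixP => u v; rewrite dpart_mxE//; last exact: smooth_at_col_mx.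
case: (split_ordP u) => w ->; rewrite ?col_mxEu ?col_mxEd dpart_mxE//.
  by congr (dpart i a _ p); apply/funext => q; rewrite col_mxEu.
by congr (dpart i a _ p); apply/funext => q; rewrite col_mxEd.
Qed.

Lemma dpart_block_mx {r s t u} i a (A : M -> 'M[R]_(r, s)) (B : M -> 'M[R]_(r, t))
    (C : M -> 'M[R]_(u, s)) (D : M -> 'M[R]_(u, t)) p :
  dom i p -> smooth_at A p -> smooth_at B p -> smooth_at C p -> smooth_at D p ->
  dpart i a (fun q => block_mx (A q) (B q) (C q) (D q)) p =
  block_mx (dpart i a A p) (dpart i a B p) (dpart i a C p) (dpart i a D p).
Proof.
by move=> ip sA sB sC sD; rewrite dpart_col_mx ?dpart_row_mx//; exact: smooth_at_row_mx.
Qed.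

Lemma smooth_at_ursubmx {r s t u} (f : M -> 'M[R]_(r + s, t + u)) p :
  smooth_at f p -> smooth_at (fun q => ursubmx (f q)) p.
Proof.
move=> sf; apply/smooth_at_mxP => v w.
under [X in smooth_at X]funext do rewrite !mxE.
exact: smooth_at_coord.
Qed.

Lemma smooth_at_det {r} (f : M -> 'M[R]_r) p :
  smooth_at f p -> smooth_at (fun q => \det (f q)) p.
Proof.
move=> sf; apply: smooth_at_sum => w _; apply: smooth_atM.
  exact: smooth_at_cst.
by apply: smooth_at_prod => k _; exact: smooth_at_coord.
Qed.

(** Cramer's rule: the entries of the inverse are cofactors divided by the determinant. *)
Lemma smooth_at_invmx {r} (f : M -> 'M[R]_r) p W : open W -> W p ->
  (forall q, W q -> f q \in unitmx) -> smooth_at f p ->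
  smooth_at (fun q => invmx (f q)) p.
Proof.
move=> oW Wp fu sf.
apply: (@smooth_at_eq _ (fun q => (\det (f q))^-1 *: \adj (f q)) _ _ W) => //.
  by move=> q Wq; rewrite /invmx fu.
apply: smooth_mxZ.
  apply: (smooth_atV oW Wp); last exact: smooth_at_det.
  by move=> q /fu; rewrite unitmxE unitfE.
apply/smooth_at_mxP => u v.
under [X in smooth_at X]funext do rewrite mxE.
apply: smooth_atM; first exact: smooth_at_cst.
apply: smooth_at_det; apply/smooth_at_mxP => u' v'.
under [X in smooth_at X]funext do rewrite !mxE.
exact: smooth_at_coord.
Qed.

End ManifoldCalculus.

(** * Smooth maps, Jacobians and the chain rule *)

Section Maps.
Context {R : realType} {m m' : nat} {M : manifold R m} {N : manifold R m'}.
Variables (f : M -> N) (fs : smooth_map f).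
Implicit Types (p q : M) (i : chart M) (j : chart N).

Lemma open_preim_dom j : open (f @^-1` dom j).
Proof. by apply: open_comp; [move=> q _; exact: fs.1|exact: dom_open]. Qed.

Lemma smooth_at_phi j p : dom j (f p) -> smooth_at (fun q => phi j (f q)) p.
Proof. by move=> jp; apply: csmooth_at (fs.2 j) jp; exact: open_preim_dom. Qed.

Lemma jacE i j p c a :
  jac f i j p c a = dpart i a (fun q => phi j (f q)) p 0 c.
Proof. by rewrite mxE. Qed.

#[local] Opaque jac.

Lemma smooth_at_jac i j p : dom i p -> dom j (f p) -> smooth_at (jac f i j) p.
Proof.
move=> ip jp; apply/smooth_at_mxP => c a.
under [X in smooth_at X]funext do rewrite jacE.
by apply/smooth_at_coord/smooth_mx_dpart => //; exact: smooth_at_phi.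
Qed.

Lemma smooth_at_comp (g : N -> R) p : smooth_at g (f p) ->
  smooth_at (fun q => g (f q)) p.
Proof.
move=> [W [oW Wp sg]]; have [j jp] := dom_cover (f p).
have oV : open (f @^-1` (W `&` dom j)).
  by apply: open_comp => [q _|]; [exact: fs.1|apply: openI => //; exact: dom_open].
exists (f @^-1` (W `&` dom j)); split=> // i.
apply: (@smooth_eq _ _ _ _ (fun x => (g \o psi j) ((phi j \o f \o psi i) x))).
- exact: chart_image_open.
- by move=> x /chart_image_psi[[_ /= jx] _ _]; rewrite phiK.
apply: (@smooth_comp _ _ _ _ (phi j @` (W `&` dom j)) (phi j \o f \o psi i)
  (g \o psi j)).
- exact: chart_image_open.
- by move=> x /chart_image_psi[[/= Wx jx] _ _]; exists (f (psi i x)).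
- apply: (smooth_subset _ (fs.2 j i)); apply: image_subset.
  by move=> q [[_ ?] ?].
- exact: sg.
Qed.

Lemma dpart_comp i j a (g : N -> R) p : dom i p -> dom j (f p) ->
  smooth_at g (f p) ->
  dpart i a (fun q => g (f q)) p = \sum_c jac f i j p c a * dpart j c g (f p).
Proof.
move=> ip jp sg.
transitivity (dpart i a (fun q => (g \o psi j) (phi j (f q))) p).
  apply: (@dpart_eq _ _ _ _ i a _ _ p (f @^-1` dom j)) => //; first exact: open_preim_dom.
  move=> q jq.
  by rewrite /= phiK.
have dF := smooth_at_differentiable (smooth_at_phi jp) ip.
have dg : differentiable (g \o psi j) (phi j (f (psi i (phi i p)))).
  by rewrite phiK//; exact: smooth_at_differentiable.
rewrite [LHS](@derive_comp _ _ _ ((fun q => phi j (f q)) \o psi i) (g \o psi j)) //.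
by apply: eq_bigr => c _; rewrite /= phiK// jacE.
Qed.

Lemma smooth_mx_comp {r s} (g : N -> 'M[R]_(r, s)) p : smooth_at g (f p) ->
  smooth_at (fun q => g (f q)) p.
Proof.
move=> sg; apply/smooth_at_mxP => u v.
exact: (smooth_at_comp (smooth_at_coord u v sg)).
Qed.

Lemma dpart_mx_comp {r s} i j a (g : N -> 'M[R]_(r, s)) p : dom i p ->
  dom j (f p) -> smooth_at g (f p) ->
  dpart i a (fun q => g (f q)) p = \sum_c jac f i j p c a *: dpart j c g (f p).
Proof.
move=> ip jp sg; apply/matrixP => u v; rewrite summxE dpart_mxE//; last exact: smooth_mx_comp.
rewrite (@dpart_comp _ j _ (fun y => g y u v))//; last exact: smooth_at_coord.
by apply: eq_bigr => c _; rewrite [RHS]mxE dpart_mxE//.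
Qed.

(** Second derivatives of the components of [f] commute. In [curv_pullback] this cancels the only
    terms that are not tensorial. *)
Lemma dpart_jac_sym i j a b p : dom i p -> dom j (f p) -> forall c,
  dpart i a (jac f i j) p c b = dpart i b (jac f i j) p c a.
Proof.
move=> ip jp c; have sF := smooth_at_phi jp.
have sJ := smooth_at_jac ip jp.
have E d e : dpart i d (jac f i j) p c e =
    dpart i d (dpart i e (fun q => phi j (f q))) p 0 c.
  rewrite !dpart_mxE//; last exact: smooth_mx_dpart.
  by congr (dpart i d _ p); apply/funext => q; rewrite jacE.
apply: etrans (E a b) (etrans _ (esym (E b a))).
exact: (congr1 (fun A : 'rV_m' => A 0 c) (dpart_mx_schwarz a b ip sF)).
Qed.

End Maps.

Section Jacobians.
Context {R : realType} {m : nat} (M : manifold R m).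

Lemma smooth_map_id : smooth_map (id : M -> M).
Proof.
split=> [p|j i]; first exact: cvg_id.
by rewrite setIC; exact: chart_smooth.
Qed.

Lemma jac_id (i : chart M) p : dom i p -> jac (id : M -> M) i i p = 1%:M.
Proof.
move=> ip; apply/matrixP => c a; rewrite jacE mxE.
rewrite /dpart (@near_eq_derive _ _ _ _ id); last first.
  apply: (@eq_near_open _ _ _ (phi i @` (setT `&` dom i))).
  - exact/chart_image_open/openT.
  - by exists p.
  - by move=> x /chart_image_psi[_ _].
by rewrite derive_id mxE eqxx.
Qed.

Lemma jac_comp {m' m''} (N : manifold R m') (P : manifold R m'')
    (f : M -> N) (g : N -> P) i j q p : smooth_map f -> smooth_map g ->
  dom i p -> dom j (f p) -> dom q (g (f p)) ->
  jac (g \o f) i q p = jac g j q (f p) *m jac f i j p.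
Proof.
move=> fs gs ip jp qp; apply/matrixP => c a; rewrite jacE mxE.
rewrite (dpart_mx_comp fs a (g := fun y => phi q (g y)) ip jp); last exact: smooth_at_phi.
rewrite summxE; apply: eq_bigr => d _; rewrite [LHS]mxE mulrC; congr (_ * _).
by rewrite jacE.
Qed.

Lemma jac_compE {m' m''} (N : manifold R m') (P : manifold R m'')
    (f : M -> N) (g : N -> P) i j q p c a : smooth_map f -> smooth_map g ->
  dom i p -> dom j (f p) -> dom q (g (f p)) ->
  jac (g \o f) i q p c a = \sum_d jac g j q (f p) c d * jac f i j p d a.
Proof.
by move=> fs gs ip jp qp; rewrite (jac_comp fs gs ip jp qp) [LHS]mxE.
Qed.

Lemma jac_id_comp (i j k : chart M) p : dom i p -> dom j p -> dom k p ->
  jac (id : M -> M) i k p = jac (id : M -> M) j k p *m jac (id : M -> M) i j p.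
Proof.
move=> ip jp kp.
exact: (jac_comp smooth_map_id smooth_map_id).
Qed.

Lemma tangent_is_vbundle : is_vbundle (tangent M).
Proof.
split=> [k|p|k l|k p|k l q p] /=.
- exact: dom_open.
- exact: dom_cover.
- apply: csmoothP => p [kp lp].
  exact: (smooth_at_jac smooth_map_id).
- exact: jac_id.
- by move=> *; exact: jac_id_comp.
Qed.

End Jacobians.

#[local] Opaque dpart jac.

(** For identities valid in every noncommutative ring: once products are distributed, each product
    is treated as an unknown matrix and the remaining additive identity is checked entrywise. *)
Ltac mx_abel :=
  repeat match goal with |- context [@dpart ?R ?m ?M ?V ?i ?a ?B ?p] =>
    let t := constr:(@dpart R m M V i a B p) in move: t => ? end;
  rewrite ?(mulmxDl, mulmxDr, mulmxBl, mulmxBr, mulNmx, mulmxN, mulmxA, opprD, opprK);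
  repeat match goal with |- context [@mulmx ?S ?k ?l ?n ?A ?B] =>
    let t := constr:(@mulmx S k l n A B) in move: t => ? end;
  apply/matrixP => ? ?; rewrite !mxE; ring.

(** * Curvature of a connection *)

Section LocalConnections.
Context {R : realType} {m : nat} (M : manifold R m) (i : chart M).
Implicit Types (p q : M).

Definition curv {r} (A : M -> 'I_m -> 'M[R]_r) (a b : 'I_m) p : 'M[R]_r :=
  dpart i a (A ^~ b) p - dpart i b (A ^~ a) p + A p a *m A p b - A p b *m A p a.

Lemma curvE {r} (A : M -> 'I_m -> 'M[R]_r) a b p : curv A a b p =
  dpart i a (A ^~ b) p - dpart i b (A ^~ a) p + A p a *m A p b - A p b *m A p a.
Proof. by []. Qed.

Lemma curv_eq {r} (A B : M -> 'I_m -> 'M[R]_r) a b p (W : set M) :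
  dom i p -> open W -> W p -> (forall q, W q -> A q = B q) ->
  curv A a b p = curv B a b p.
Proof.
move=> ip oW Wp AB; rewrite /curv -(AB p Wp).
have E c d : dpart i c (A ^~ d) p = dpart i c (B ^~ d) p.
  by apply: (dpart_eq c ip oW Wp) => q /AB ->.
by rewrite (E a b) (E b a).
Qed.

Lemma smooth_at_curv {r} (A : M -> 'I_m -> 'M[R]_r) a b p : dom i p ->
  (forall c, smooth_at (A ^~ c) p) -> smooth_at (curv A a b) p.
Proof.
move=> ip sA; rewrite /curv; do !apply: smooth_mxD; try apply: smooth_mxN.
- exact: smooth_mx_dpart.
- exact: smooth_mx_dpart.
- exact: smooth_mxM.
- exact: smooth_mxM.
Qed.

(* Apply d_a to d_b h = h A_b - B_b h and antisymmetrise in a and b. *)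
Lemma curv_intertwine {r s} (A : M -> 'I_m -> 'M[R]_r) (B : M -> 'I_m -> 'M[R]_s)
    (h : M -> 'M[R]_(s, r)) a b p (W : set M) :
  dom i p -> open W -> W p -> smooth_at h p ->
  (forall c, smooth_at (A ^~ c) p) -> (forall c, smooth_at (B ^~ c) p) ->
  (forall q c, W q -> dpart i c h q + B q c *m h q = h q *m A q c) ->
  curv B a b p *m h p = h p *m curv A a b p.
Proof.
move=> ip oW Wp sh sA sB hE.
have dhE c q : W q -> dpart i c h q = h q *m A q c - B q c *m h q.
  by move=> Wq; rewrite -hE// addrK.
have ddhE c d : dpart i c (dpart i d h) p =
    (h p *m A p c - B p c *m h p) *m A p d + h p *m dpart i c (A ^~ d) p
    - (dpart i c (B ^~ d) p *m h p + B p d *m (h p *m A p c - B p c *m h p)).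
  rewrite (dpart_eq c ip oW Wp (dhE d)).
  rewrite dpart_mxD//; [|exact: smooth_mxM|by apply/smooth_mxN/smooth_mxM].
  rewrite dpart_mxN//; last exact: smooth_mxM.
  by rewrite !dpart_mxM// dhE.
have := dpart_mx_schwarz a b ip sh; rewrite !ddhE => /eqP.
rewrite -subr_eq0 => /eqP E; apply/eqP; rewrite eq_sym -subr_eq0 -{}E; apply/eqP.
rewrite /curv; mx_abel.
Qed.

(** Second derivatives cancel in pairs by [dpart_mx_schwarz], and the rest is an identity in a
    noncommutative ring. In the cyclic sum no Christoffel symbols for the form indices appear. *)
Lemma second_bianchi {r} (A : M -> 'I_m -> 'M[R]_r) a b c p : dom i p ->
  (forall d, smooth_at (A ^~ d) p) ->
  dpart i a (curv A b c) p + A p a *m curv A b c p - curv A b c p *m A p a +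
  (dpart i b (curv A c a) p + A p b *m curv A c a p - curv A c a p *m A p b) +
  (dpart i c (curv A a b) p + A p c *m curv A a b p - curv A a b p *m A p c) = 0.
Proof.
move=> ip sA.
have dcurvE d e f : dpart i d (curv A e f) p =
    dpart i d (dpart i e (A ^~ f)) p - dpart i d (dpart i f (A ^~ e)) p +
    (dpart i d (A ^~ e) p *m A p f + A p e *m dpart i d (A ^~ f) p) -
    (dpart i d (A ^~ f) p *m A p e + A p f *m dpart i d (A ^~ e) p).
  have s1 := smooth_mx_dpart e ip (sA f).
  have s2 := smooth_mx_dpart f ip (sA e).
  have s3 := smooth_mxM (sA e) (sA f).
  have s4 := smooth_mxM (sA f) (sA e).
  rewrite dpart_mxD//; [|do !apply: smooth_mxD => //; exact: smooth_mxN|exact: smooth_mxN].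
  rewrite dpart_mxN// dpart_mxD//; last by apply: smooth_mxD => //; exact: smooth_mxN.
  rewrite dpart_mxD//; last exact: smooth_mxN.
  by rewrite dpart_mxN// !dpart_mxM.
rewrite !dcurvE (dpart_mx_schwarz b a ip (sA c)) (dpart_mx_schwarz c a ip (sA b))
  (dpart_mx_schwarz c b ip (sA a)).
rewrite /curv; move: (A p a) (A p b) (A p c) => X Y Z; mx_abel.
Qed.

End LocalConnections.

(** * Pullback of connections and commutators of covariant derivatives *)

Section Pullback.
Context {R : realType} {m m' : nat} {M : manifold R m} {N : manifold R m'}.
Variables (f : M -> N) (fs : smooth_map f) (i : chart M) (j : chart N).

Lemma curv_pullback {r} (B : N -> 'I_m' -> 'M[R]_r) a b p :
  dom i p -> dom j (f p) -> (forall c, smooth_at (B ^~ c) (f p)) ->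
  curv i (fun q e => \sum_d jac f i j q d e *: B (f q) d) a b p =
  \sum_c \sum_d (jac f i j p c a * jac f i j p d b) *: curv j B c d (f p).
Proof.
move=> ip jp sB.
have sJ d e : smooth_at (fun q => jac f i j q d e) p.
  exact/smooth_at_coord/smooth_at_jac.
have dE d e : dpart i d (fun q => \sum_c jac f i j q c e *: B (f q) c) p =
    \sum_c dpart i d (jac f i j) p c e *: B (f p) c +
    \sum_c \sum_c' (jac f i j p c' d * jac f i j p c e) *: dpart j c' (B ^~ c) (f p).
  rewrite dpart_mx_sum// => [|c]; last first.
    by apply: smooth_mxZ => //; exact: (smooth_mx_comp fs (sB c)).
  rewrite -big_split; apply: eq_bigr => c _ /=.
  rewrite dpart_mxZ//; last exact: (smooth_mx_comp fs (sB c)).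
  congr (_ + _); first by rewrite dpart_mxE//; exact: smooth_at_jac.
  rewrite (dpart_mx_comp fs d ip jp (sB c)) scaler_sumr.
  by apply: eq_bigr => c' _; rewrite scalerA mulrC.
have pE d e : (\sum_c jac f i j p c d *: B (f p) c) *m
    (\sum_c jac f i j p c e *: B (f p) c) =
    \sum_c \sum_c' (jac f i j p c d * jac f i j p c' e) *: (B (f p) c *m B (f p) c').
  rewrite mulmx_suml; apply: eq_bigr => c _; rewrite mulmx_sumr.
  by apply: eq_bigr => c' _; rewrite -scalemxAl -scalemxAr scalerA.
rewrite /curv !dE !pE.
have -> : \sum_c dpart i b (jac f i j) p c a *: B (f p) c =
          \sum_c dpart i a (jac f i j) p c b *: B (f p) c.
  by apply: eq_bigr => c _; congr (_ *: _); exact: (dpart_jac_sym fs).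
rewrite opprD addrACA subrr add0r.
rewrite [X in X - _ + _ - _]exchange_big [X in _ + _ - X]exchange_big /=.
rewrite -sumrB -big_split -sumrB /=; apply: eq_bigr => c _.
rewrite -sumrB -big_split -sumrB /=; apply: eq_bigr => d _.
rewrite [in X in _ - X + _ - _]mulrC [in X in _ + _ - X]mulrC.
by rewrite -!scalerBr -scalerDr -scalerBr.
Qed.

End Pullback.

Section Commutator.
Context {R : realType} {m : nat} (M : manifold R m).

(** The Christoffel terms cancel because [G] is torsion-free, and the second derivatives of [S] by
    Schwarz. The commutator is therefore algebraic in [S], and all later work can be done with
    [curv]. *)
Lemma commutatorE (G : conn_form (tangent M)) {r} (E : vbundle M r) (A : conn_form E)
    S (k : triv E) (i : chart M) a b p :
  dom i p -> (forall c, christoffel G i p a b c = christoffel G i p b a c) ->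
  smooth_at (S k) p -> (forall c, smooth_at ((A k i) ^~ c) p) ->
  commutator G A S k i a b p = curv i (A k i) a b p *m S k p.
Proof.
move=> ip Gs sS sA.
have dE c d : dpart i c (covd A S k i d) p =
    dpart i c (dpart i d (S k)) p + (dpart i c ((A k i) ^~ d) p *m S k p +
    A k i p d *m dpart i c (S k) p).
  rewrite /covd dpart_mxD//; [|exact: smooth_mx_dpart|exact: smooth_mxM].
  by rewrite dpart_mxM.
rewrite /commutator /covd2 !dE.
have -> : \sum_c christoffel G i p a b c *: covd A S k i c p =
          \sum_c christoffel G i p b a c *: covd A S k i c p.
  by apply: eq_bigr => c _; rewrite Gs.
rewrite opprD addrACA subrr addr0 (dpart_mx_schwarz b a ip sS).
rewrite /covd /curv; move: (A k i p a) (A k i p b) (S k p) => X Y Z.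
mx_abel.
Qed.

End Commutator.

#[local] Opaque dpart jac curv.

Section CurvNatural.
Context {R : realType} {m m' : nat} {M : manifold R m} {N : manifold R m'}.
Variables (f : M -> N) (fs : smooth_map f) (i : chart M) (j : chart N).

(** A parallel [h] over [f] is a gauge transformation over [M] between [A] and the pullback of [B],
    so [curv_intertwine] applies, and [curv_pullback] evaluates the curvature of the pullback. *)
Lemma curv_natural {r s} (A : M -> 'I_m -> 'M[R]_r) (B : N -> 'I_m' -> 'M[R]_s)
    (h : M -> 'M[R]_(s, r)) a b p (W : set M) :
  dom i p -> dom j (f p) -> open W -> W p -> smooth_at h p ->
  (forall c, smooth_at (A ^~ c) p) -> (forall c, smooth_at (B ^~ c) (f p)) ->
  (forall q c, W q -> dpart i c h q + \sum_d jac f i j q d c *: (B (f q) d *m h q)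
    = h q *m A q c) ->
  (\sum_c \sum_d (jac f i j p c a * jac f i j p d b) *: curv j B c d (f p)) *m h p
  = h p *m curv i A a b p.
Proof.
move=> ip jp oW Wp sh sA sB E; rewrite -curv_pullback//.
apply: (curv_intertwine a b ip oW Wp sh sA).
  move=> c; apply: smooth_mx_sum => d _; apply: smooth_mxZ.
    exact/smooth_at_coord/smooth_at_jac.
  exact: (smooth_mx_comp fs (sB d)).
move=> q c Wq /=; rewrite mulmx_suml -E//; congr (_ + _).
by apply: eq_bigr => d _; rewrite scalemxAl.
Qed.

End CurvNatural.

Lemma mxtrace_similar (R : comUnitRingType) n (H V W : 'M[R]_n) :
  H \in unitmx -> H *m V = W *m H -> \tr V = \tr W.
Proof. by move=> Hu E; rewrite -(mulKmx Hu V) E mxtrace_mulC mulmxK. Qed.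

(** The contraction pairs a form index with the vector index, so it is not the trace of any single
    [F a b]. For fixed [b] and [d] it is the trace of the matrix [V] below, which the hypothesis
    makes similar to [W]. *)
Lemma contraction_natural (R : comUnitRingType) n (H : 'M[R]_n)
    (F G : 'I_n -> 'I_n -> 'M[R]_n) : H \in unitmx ->
  (forall a b, (\sum_c \sum_e (H c a * H e b) *: G c e) *m H = H *m F a b) ->
  \matrix_(b, d) (\sum_a F a b a d) =
  H^T *m \matrix_(b, d) (\sum_a G a b a d) *m H.
Proof.
move=> Hu E; apply/matrixP => b d.
pose V := \matrix_(c, a) F a b c d.
pose W := \matrix_(c, e) \sum_g H g b * (G e g *m H) c d.
have tV : \tr V = \tr W.
  apply: (mxtrace_similar Hu); apply/matrixP => c a.
  transitivity ((H *m F a b) c d).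
    by rewrite !mxE; apply: eq_bigr => e _; rewrite mxE.
  rewrite -E mulmx_suml summxE mxE; apply: eq_bigr => e _.
  rewrite mulmx_suml summxE mxE mulr_suml; apply: eq_bigr => g _.
  by rewrite -scalemxAl mxE [RHS]mulrC mulrA.
transitivity (\tr V).
  by rewrite mxE; apply: eq_bigr => a _; rewrite mxE.
rewrite tV /mxtrace; under eq_bigr do rewrite mxE.
rewrite exchange_big -mulmxA mxE; apply: eq_bigr => g _ /=.
rewrite mxE -mulr_sumr; congr (_ * _).
rewrite [RHS]mxE; under eq_bigr do rewrite mxE.
rewrite exchange_big; apply: eq_bigr => e _ /=.
by rewrite mxE mulr_suml.
Qed.

(** * Ricci tensor and tractor connection *)

Section TwoColumns.
Context {R : pzRingType} {r : nat}.
Implicit Types (u v : 'cV[R]_r) (x y : 'rV[R]_r).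

(* Typed with 2 rather than 1 + 1, so that scaling and addition of these matrices
   match the algebraic structures of 'M_(_, 2). *)
Definition cols2 u v : 'M[R]_(r, 2) := row_mx u v.
Definition rows2 x y : 'M[R]_(2, r) := col_mx x y.

Lemma cols2E0 u v c : cols2 u v c 0 = u c 0.
Proof. by rewrite -[RHS](row_mxEl u v); congr (row_mx _ _ _ _); apply: val_inj. Qed.

Lemma cols2E1 u v c : cols2 u v c 1 = v c 0.
Proof. by rewrite -[RHS](row_mxEr u v); congr (row_mx _ _ _ _); apply: val_inj. Qed.

Lemma rows2E0 x y c : rows2 x y 0 c = x 0 c.
Proof. by rewrite -[RHS](col_mxEu x y); congr (col_mx _ _ _ _); apply: val_inj. Qed.

Lemma rows2E1 x y c : rows2 x y 1 c = y 0 c.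
Proof. by rewrite -[RHS](col_mxEd x y); congr (col_mx _ _ _ _); apply: val_inj. Qed.

Lemma scale_cols2 a u v : a *: cols2 u v = cols2 (a *: u) (a *: v).
Proof. exact: (@scale_row_mx _ r 1 1 a u v). Qed.

Lemma scale_rows2 a x y : a *: rows2 x y = rows2 (a *: x) (a *: y).
Proof. exact: (@scale_col_mx _ 1 1 r a x y). Qed.

Lemma add_cols2 u v u' v' : cols2 u v + cols2 u' v' = cols2 (u + u') (v + v').
Proof. exact: (@add_row_mx _ r 1 1 u v u' v'). Qed.

Lemma add_rows2 x y x' y' : rows2 x y + rows2 x' y' = rows2 (x + x') (y + y').
Proof. exact: (@add_col_mx _ 1 1 r x y x' y'). Qed.

Lemma opp_cols2 u v : - cols2 u v = cols2 (- u) (- v).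
Proof. exact: (@opp_row_mx _ r 1 1 u v). Qed.

Lemma opp_rows2 x y : - rows2 x y = rows2 (- x) (- y).
Proof. exact: (@opp_col_mx _ 1 1 r x y). Qed.

Lemma cols2_0 : cols2 0 0 = 0.
Proof. exact: (@row_mx0 _ r 1 1). Qed.

Lemma rows2_0 : rows2 0 0 = 0.
Proof. exact: (@col_mx0 _ 1 1 r). Qed.

Lemma mulmx_cols2_rows2 u v x y : cols2 u v *m rows2 x y = u *m x + v *m y.
Proof. exact: (@mul_row_col _ r 1 1 r u v x y). Qed.

Lemma sum_cols2 I (s : seq I) (F G : I -> 'cV[R]_r) :
  \sum_(d <- s) cols2 (F d) (G d) = cols2 (\sum_(d <- s) F d) (\sum_(d <- s) G d).
Proof.
elim: s => [|d s IH]; first by rewrite !big_nil cols2_0.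
by rewrite !big_cons IH add_cols2.
Qed.

Lemma sum_rows2 I (s : seq I) (F G : I -> 'rV[R]_r) :
  \sum_(d <- s) rows2 (F d) (G d) = rows2 (\sum_(d <- s) F d) (\sum_(d <- s) G d).
Proof.
elim: s => [|d s IH]; first by rewrite !big_nil rows2_0.
by rewrite !big_cons IH add_rows2.
Qed.

End TwoColumns.

Lemma mulmx_cols2 (R : pzRingType) r s (A : 'M[R]_(s, r)) u v :
  A *m cols2 u v = cols2 (A *m u) (A *m v).
Proof. exact: (@mul_mx_row _ _ _ 1 1 A u v). Qed.

Lemma mulmx_rows2 (R : pzRingType) r s (A : 'M[R]_(r, s)) x y :
  rows2 x y *m A = rows2 (x *m A) (y *m A).
Proof. exact: (@mul_col_mx _ 1 1 _ _ x y A). Qed.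

Section SymplecticBasics.
Context {R : realType} {n : nat}.
Notation m := (2 * n)%N.

Section OneSymplectic.
Variable M : symplectic R n.
Implicit Types (p q : M) (i j k : chart M).

Definition gam i p a : 'M[R]_m := @nabla _ n M i i p a.

Lemma smooth_at_J i p : dom i p -> smooth_at (J i) p.
Proof. by move=> ip; exact: csmooth_at (dom_open i) ((J_tensor M).1 i) ip. Qed.

Lemma smooth_at_gam i p a : dom i p -> smooth_at (fun q => gam i q a) p.
Proof.
move=> ip; have := (nabla_connection M).1 i i a; rewrite /= setIid => sG.
exact: csmooth_at (dom_open i) sG ip.
Qed.

Lemma smooth_at_Jup i p : dom i p -> smooth_at (Jup i) p.
Proof.
move=> ip; apply: (smooth_at_invmx (dom_open i) ip).
  by move=> q iq; rewrite unitmx_tr J_nondegenerate.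
exact/smooth_mxT/smooth_at_J.
Qed.

Definition ric i p : 'M[R]_m :=
  \matrix_(b, d) \sum_a curv i (gam i) a b p a d.

Definition Rho i p : 'M[R]_m := (2 * n + 2)%:R^-1 *: ric i p.

Lemma smooth_at_ric i p : dom i p -> smooth_at (ric i) p.
Proof.
move=> ip; apply/smooth_at_mxP => b d.
under [X in smooth_at X]funext do rewrite mxE.
apply: smooth_at_sum => a _; apply: smooth_at_coord.
by apply: smooth_at_curv => // c; exact: smooth_at_gam.
Qed.

Lemma smooth_at_Rho i p : dom i p -> smooth_at (Rho i) p.
Proof.
by move=> ip; apply: smooth_mxZ; [exact: smooth_at_cst|exact: smooth_at_ric].
Qed.

(** A change of chart is the case f = id of naturality, so each transformation law is proved only
    once. *)
Lemma id_morphism : is_morphism (id : M -> M).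
Proof.
split; first exact: smooth_map_id.
- exact: (J_tensor M).2.
- exact: (nabla_connection M).2.
Qed.

(* The components are ordered as X (2n of them), s, r; the last argument a of
   tract is the index of the 1-form. *)
Definition tract i (S : M -> 'I_m -> R) p a : 'M[R]_(m + 2) :=
  block_mx (gam i p a)
    (cols2 (col a (Jup i p *m Rho i p)) (delta_mx a 0))
    (rows2 (row a (J i p)) (- row a (Rho i p)))
    (S p a *: delta_mx 1 0).

Lemma smooth_at_tract i S p a : dom i p -> smooth_at (S ^~ a) p ->
  smooth_at (fun q => tract i S q a) p.
Proof.
move=> ip sS; apply: smooth_at_block_mx.
- exact: smooth_at_gam.
- apply: (@smooth_at_row_mx _ _ _ _ 1 1); last exact: smooth_at_cst.
  by apply/smooth_at_col/smooth_mxM; [exact: smooth_at_Jup|exact: smooth_at_Rho].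
- apply: (@smooth_at_col_mx _ _ _ 1 _ 1); first exact/smooth_at_row/smooth_at_J.
  exact/smooth_mxN/smooth_at_row/smooth_at_Rho.
- by apply: smooth_mxZ => //; exact: smooth_at_cst.
Qed.

(* The entry s -> TM of the curvature for S = 0 is
   nabla_a Phi_b^c - nabla_b Phi_a^c; its trace over a = c is nabla_a Phi_b^a,
   since Phi_a^a = 0. *)
Definition schouten1 i p (b : 'I_m) : R :=
  - (2 * n + 1)%:R^-1 *
  \sum_a ursubmx (curv i (tract i (fun _ _ => 0)) a b p) a 0.

Lemma smooth_at_schouten1 i p b : dom i p -> smooth_at (fun q => schouten1 i q b) p.
Proof.
move=> ip; apply: smooth_atM; first exact: smooth_at_cst.
apply: smooth_at_sum => a _.
apply: smooth_at_coord; apply: smooth_at_ursubmx.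
apply: smooth_at_curv => // c; apply: smooth_at_tract => //.
exact: smooth_at_cst.
Qed.

End OneSymplectic.

Section TwoSymplectic.
Variables (M N : symplectic R n) (f : M -> N) (fm : is_morphism f).
Implicit Types (p q : M) (i : chart M) (j : chart N).
Let fs : smooth_map f. Proof. by case: fm. Qed.

(** The determinant of the Jacobian divides that of [J i p], which is a unit. *)
Lemma jac_unit i j p : dom i p -> dom j (f p) -> jac f i j p \in unitmx.
Proof.
move=> ip jp; have [_ /(_ i j p ip jp) E _] := fm.
have := J_nondegenerate ip; rewrite E !unitmxE !det_mulmx !unitrM.
by case/andP.
Qed.

Lemma gam_natural i j p a : dom i p -> dom j (f p) ->
  dpart i a (jac f i j) p
    + \sum_d jac f i j p d a *: (gam j (f p) d *m jac f i j p)
  = jac f i j p *m gam i p a.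
Proof. by move=> ip jp; have [_ _] := fm; apply. Qed.

Let W i j := dom i `&` f @^-1` dom j.
Let oW i j : open (W i j).
Proof. by apply: openI; [exact: dom_open|exact: (open_preim_dom fs)]. Qed.

(** For [nabla] the parallel map over [f] is the Jacobian itself, which thus acts both as gauge
    transformation and on the form indices. *)
Lemma ric_natural i j p : dom i p -> dom j (f p) ->
  ric i p = (jac f i j p)^T *m ric j (f p) *m jac f i j p.
Proof.
move=> ip jp; set H := jac f i j p.
have E a b : (\sum_c \sum_e (H c a * H e b) *: curv j (gam j) c e (f p)) *m H =
    H *m curv i (gam i) a b p.
  apply: (@curv_natural _ _ _ _ _ _ fs i j _ _ (gam i) (gam j) (jac f i j)
    a b p (W i j) ip jp (oW i j)) => //.
  - exact: (smooth_at_jac fs).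
  - by move=> c; exact: (smooth_at_gam c ip).
  - by move=> c; exact: (smooth_at_gam c jp).
  - by move=> q c [iq jq]; exact: gam_natural.
exact: (contraction_natural (jac_unit ip jp) E).
Qed.

Lemma Rho_natural i j p : dom i p -> dom j (f p) ->
  Rho i p = (jac f i j p)^T *m Rho j (f p) *m jac f i j p.
Proof.
by move=> ip jp; rewrite /Rho (ric_natural ip jp) -scalemxAr -scalemxAl.
Qed.

Lemma J_natural i j p : dom i p -> dom j (f p) ->
  J i p = (jac f i j p)^T *m J j (f p) *m jac f i j p.
Proof. by have [_ + _] := fm; apply. Qed.

End TwoSymplectic.

End SymplecticBasics.

Lemma sum_block_mx (V : nmodType) r s t u I (rr : seq I) (A : I -> 'M[V]_(r, s))
    (B : I -> 'M[V]_(r, t)) (C : I -> 'M[V]_(u, s)) (D : I -> 'M[V]_(u, t)) :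
  \sum_(d <- rr) block_mx (A d) (B d) (C d) (D d) =
  block_mx (\sum_(d <- rr) A d) (\sum_(d <- rr) B d) (\sum_(d <- rr) C d)
    (\sum_(d <- rr) D d).
Proof.
elim: rr => [|d rr IH]; first by rewrite !big_nil /block_mx !row_mx0 col_mx0.
by rewrite !big_cons IH add_block_mx.
Qed.

(** * Naturality *)

Section Algebra.
Context {R : comUnitRingType} {m : nat}.
Implicit Types (H X : 'M[R]_m) (a : 'I_m).

Lemma mulmx_col_sum r (X : 'M[R]_(r, m)) H a :
  \sum_d H d a *: col d X = col a (X *m H).
Proof.
apply/matrixP => u v; rewrite summxE !mxE; apply: eq_bigr => d _.
by rewrite !mxE mulrC.
Qed.

Lemma mulmx_row_sum r (X : 'M[R]_(m, r)) H a :
  \sum_d H d a *: row d X = row a (H^T *m X).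
Proof.
by apply/matrixP => u v; rewrite summxE !mxE; apply: eq_bigr => d _; rewrite !mxE.
Qed.

Lemma sum_scale_delta H a : \sum_d H d a *: delta_mx d 0 = col a H :> 'cV_m.
Proof. by rewrite [RHS]matrix_sum_delta; apply: eq_bigr => d _; rewrite big_ord1 mxE. Qed.

(** The summands s and r are trivial line bundles: a change of chart acts on TM alone. *)
Definition extend_mx H : 'M[R]_(m + 2) := block_mx H 0 0 1%:M.

Lemma extend_mxM H X : extend_mx (H *m X) = extend_mx H *m extend_mx X.
Proof. by rewrite mulmx_block !mulmx0 !mul0mx !addr0 !add0r mulmx1. Qed.

Lemma extend_mx1 : extend_mx 1%:M = 1%:M.
Proof. by rewrite /extend_mx -scalar_mx_block. Qed.

Lemma extend_mx_unit H : H \in unitmx -> extend_mx H \in unitmx.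
Proof.
move=> Hu; have : extend_mx H *m extend_mx (invmx H) = 1%:M.
  by rewrite -extend_mxM mulmxV// extend_mx1.
by case/mulmx1_unit.
Qed.

Lemma extend_mulmx_ur H (X : 'M[R]_(m + 2)) :
  ursubmx (extend_mx H *m X) = H *m ursubmx X.
Proof.
rewrite -{1}(submxK X) mulmx_block block_mxKur.
by rewrite mul0mx addr0.
Qed.

Lemma mulmx_extend_ur H (X : 'M[R]_(m + 2)) :
  ursubmx (X *m extend_mx H) = ursubmx X.
Proof.
rewrite -{1}(submxK X) mulmx_block block_mxKur.
by rewrite mulmx0 add0r mulmx1.
Qed.

(** Counterpart of [contraction_natural] for 2-forms with values in TM, such as the entry s -> TM of
    the curvature, on whose source the structure group acts trivially. *)
Lemma vector_contraction_natural H (F G : 'I_m -> 'I_m -> 'cV[R]_m) :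
  H \in unitmx ->
  (forall a b, \sum_c \sum_e (H c a * H e b) *: G c e = H *m F a b) ->
  forall b, \sum_a F a b a 0 = \sum_g H g b * \sum_a G a g a 0.
Proof.
move=> Hu E b.
pose V := \matrix_(c, a) F a b c 0.
pose W := \matrix_(c, e) \sum_g H g b * G e g c 0.
have tV : \tr V = \tr W.
  apply: (mxtrace_similar Hu); apply/matrixP => c a.
  transitivity ((H *m F a b) c 0).
    by rewrite !mxE; apply: eq_bigr => e _; rewrite mxE.
  rewrite -E summxE mxE; apply: eq_bigr => e _.
  rewrite summxE mxE mulr_suml; apply: eq_bigr => g _.
  by rewrite mxE [RHS]mulrC mulrA.
transitivity (\tr V).
  by apply: eq_bigr => a _; rewrite mxE.
rewrite tV /mxtrace; under eq_bigr do rewrite mxE.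
by rewrite exchange_big; apply: eq_bigr => g _ /=; rewrite mulr_sumr.
Qed.

End Algebra.

Section Tractor.
Context {R : realType} {n : nat}.
Notation m := (2 * n)%N.

Lemma dpart_extend {l : nat} (M : manifold R l) (i : chart M) a k
    (h : M -> 'M[R]_k) p : dom i p -> smooth_at h p ->
  dpart i a (fun q => extend_mx (h q)) p = block_mx (dpart i a h p) 0 0 0.
Proof.
by move=> ip sh; rewrite dpart_block_mx ?dpart_cst//; exact: smooth_at_cst.
Qed.

Section TwoSymplectic.
Variables (M N : symplectic R n) (f : M -> N) (fm : is_morphism f).
Implicit Types (p q : M) (i : chart M) (j : chart N).
Let fs : smooth_map f. Proof. by case: fm. Qed.

Lemma Jup_natural i j p : dom i p -> dom j (f p) ->
  jac f i j p *m Jup i p *m (jac f i j p)^T = Jup j (f p).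
Proof.
move=> ip jp.
have JTu : (J i p)^T \in unitmx by rewrite unitmx_tr J_nondegenerate.
have JTu' : (J j (f p))^T \in unitmx by rewrite unitmx_tr J_nondegenerate.
have := J_natural fm ip jp; have := jac_unit fm ip jp; rewrite /Jup.
move: (jac f i j p) => H Hu JE.
have HTu : H^T \in unitmx by rewrite unitmx_tr.
rewrite -[LHS](mulKmx JTu') -[RHS]mulmx1; congr (_ *m _).
rewrite -[LHS](mulKmx HTu) -[RHS](mulVmx HTu); congr (_ *m _).
have -> : H^T *m ((J j (f p))^T *m (H *m invmx (J i p)^T *m H^T)) =
    (H^T *m J j (f p) *m H)^T *m invmx (J i p)^T *m H^T.
  by rewrite !trmx_mul trmxK !mulmxA.
by rewrite -JE mulmxV// mul1mx.
Qed.

Lemma JupRho_natural i j p : dom i p -> dom j (f p) ->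
  jac f i j p *m (Jup i p *m Rho i p) =
  Jup j (f p) *m Rho j (f p) *m jac f i j p.
Proof.
move=> ip jp; rewrite (Rho_natural fm ip jp) !mulmxA; do 2!congr (_ *m _).
exact: Jup_natural.
Qed.

(** [S] is left arbitrary because the law is needed twice: with S = 0 it gives the covariance of
    [schouten1], and then with [schouten1] it gives that of D. *)
Lemma tract_natural (S : M -> 'I_m -> R) (S' : N -> 'I_m -> R) i j p a :
  dom i p -> dom j (f p) ->
  S p a = \sum_d jac f i j p d a * S' (f p) d ->
  dpart i a (fun q => extend_mx (jac f i j q)) p +
    \sum_d jac f i j p d a *: (tract j S' (f p) d *m extend_mx (jac f i j p)) =
  extend_mx (jac f i j p) *m tract i S p a.
Proof.
move=> ip jp SE.
have gE := gam_natural fm a ip jp.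
have RE := Rho_natural fm ip jp.
have JE := J_natural fm ip jp.
have LE := JupRho_natural ip jp.
rewrite dpart_extend//; last exact: (smooth_at_jac fs).
rewrite [in RHS]mulmx_block !mul0mx !mul1mx !addr0 !add0r -gE.
move: (dpart i a (jac f i j) p) => dH.
move: (jac f i j p) RE JE LE SE => H RE JE LE SE {gE}.
under eq_bigr do rewrite mulmx_block !mulmx0 !mulmx1 !addr0 !add0r scale_block_mx.
rewrite sum_block_mx add_block_mx !add0r; congr block_mx.
- under eq_bigr do rewrite scale_cols2.
  rewrite sum_cols2 mulmx_col_sum -LE sum_scale_delta mulmx_cols2.
  by rewrite !colE !mulmxA.
- under eq_bigr do rewrite mulmx_rows2 scale_rows2 -row_mul mulNmx -row_mul scalerN.
  by rewrite sum_rows2 sumrN !mulmx_row_sum !mulmxA -RE -JE.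
- by rewrite SE scaler_suml; apply: eq_bigr => d _; rewrite scalerA.
Qed.

Lemma schouten1_natural i j p b : dom i p -> dom j (f p) ->
  schouten1 i p b = \sum_d jac f i j p d b * schouten1 j (f p) d.
Proof.
move=> ip jp.
pose A := tract i (fun _ _ => 0); pose B := tract j (fun _ _ => 0).
have E c e : (\sum_d \sum_g (jac f i j p d c * jac f i j p g e) *:
      curv j B d g (f p)) *m extend_mx (jac f i j p) =
    extend_mx (jac f i j p) *m curv i A c e p.
  apply: (@curv_natural _ _ _ _ _ _ fs i j _ _ A B
    (fun q => extend_mx (jac f i j q)) c e p (dom i `&` f @^-1` dom j) ip jp) => //.
  - by apply: openI; [exact: dom_open|exact: (open_preim_dom fs)].
  - apply: smooth_at_block_mx; [exact: (smooth_at_jac fs)|..]; exact: smooth_at_cst.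
  - by move=> d; apply: smooth_at_tract => //; exact: smooth_at_cst.
  - by move=> d; apply: smooth_at_tract => //; exact: smooth_at_cst.
  - move=> q d [iq jq]; apply: tract_natural => //.
    by rewrite big1// => g _; rewrite mulr0.
have Hu := jac_unit fm ip jp.
rewrite /schouten1 -/A -/B; move: (jac f i j p) Hu E => H Hu E.
have F := @vector_contraction_natural _ _ H
  (fun c e => col 0 (ursubmx (curv i A c e p)))
  (fun c e => col 0 (ursubmx (curv j B c e (f p)))) Hu _ b.
transitivity (- (2 * n + 1)%:R^-1 * \sum_a col 0 (ursubmx (curv i A a b p)) a 0).
  congr (_ * _); apply: eq_bigr => a _; by rewrite [RHS]mxE.
rewrite F => [|c e]; last first.
  (* Multiplication by [extend_mx H] on the right fixes the column s, on the left it acts by [H]: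
     the upper right block transforms as a 2-form with values in TM. *)
  rewrite [in RHS]colE mulmxA -[RHS]colE -extend_mulmx_ur -E mulmx_extend_ur.
  move: (fun d g => curv j B d g (f p)) => Y.
  apply/matrixP => u v; rewrite summxE [RHS]mxE [RHS]mxE [RHS]mxE summxE.
  apply: eq_bigr => d _; rewrite !summxE; apply: eq_bigr => g _.
  by rewrite !mxE.
rewrite mulr_sumr; apply: eq_bigr => g _; rewrite mulrCA; congr (_ * (_ * _)).
by apply: eq_bigr => d _; rewrite [LHS]mxE.
Qed.

End TwoSymplectic.

Definition tractor (M : symplectic R n) : vbundle M (m + 2) :=
  {| triv := chart M; vdom := fun i => dom i;
     trans := fun i j p => extend_mx (jac (id : M -> M) i j p) |}.

(* tract k is the connection form in the frame and the chart k; only the index of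
   the 1-form is transported to the chart i. *)
Definition tractor_conn (M : symplectic R n) : conn_form (tractor M) :=
  fun k i p a => \sum_d jac (id : M -> M) i k p d a *: tract k (schouten1 k) p d.

Definition tractor_map (M N : symplectic R n) (f : M -> N) :
  bmap (tractor M) (tractor N) := fun i j p => extend_mx (jac f i j p).

Lemma tractor_is_vbundle (M : symplectic R n) : is_vbundle (tractor M).
Proof.
have [H1 H2 _ _ _] := tangent_is_vbundle M.
split=> [//|//|k l|k p kp|k l q p kp lp qp] /=.
- apply: csmoothP => p [kp lp]; apply: smooth_at_block_mx; try exact: smooth_at_cst.
  exact: (smooth_at_jac (smooth_map_id M)).
- by rewrite jac_id// extend_mx1.
- by rewrite -extend_mxM -jac_id_comp.
Qed.

Lemma smooth_at_extend {l : nat} (M : manifold R l) k (h : M -> 'M[R]_k) p :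
  smooth_at h p -> smooth_at (fun q => extend_mx (h q)) p.
Proof. by move=> sh; apply: smooth_at_block_mx => //; exact: smooth_at_cst. Qed.

(** [tract_natural] is the law in the charts [k], [l] of the frames. The charts [i], [j] of the form
    index enter by factoring the Jacobian of [f] from [i] to [l] in two ways, through [k] and
    through [j]. *)
Lemma tractor_conn_parallel (M N : symplectic R n) (f : M -> N) :
  is_morphism f -> parallel (@tractor_conn M) (@tractor_conn N) f (@tractor_map M N f).
Proof.
move=> fm k l i j a p kp ip lp jp; rewrite /= in kp lp.
have fs : smooth_map f by case: fm.
have idM := smooth_map_id M; have idN := smooth_map_id N.
have tE e := tract_natural fm kp lp (schouten1_natural fm e kp lp).
rewrite /tractor_conn [RHS]mulmx_sumr.
under [RHS]eq_bigr do rewrite -scalemxAr -tE scalerDr.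
rewrite big_split /=; congr (_ + _).
  rewrite (dpart_mx_comp idM a (g := tractor_map f k l) ip kp)//.
  apply: smooth_at_extend; exact: (smooth_at_jac fs).
rewrite -[extend_mx _]/(tractor_map f k l p); move: (tractor_map f k l p) => X.
transitivity (\sum_d \sum_e (jac f k l p d e * jac (id : M -> M) i k p e a) *:
    (tract l (schouten1 l) (f p) d *m X)).
  transitivity (\sum_d jac f i l p d a *: (tract l (schouten1 l) (f p) d *m X)).
    under eq_bigr do rewrite mulmx_suml scaler_sumr.
    rewrite exchange_big; apply: eq_bigr => d _ /=.
    under eq_bigr do rewrite -scalemxAl scalerA.
    rewrite -scaler_suml; congr (_ *: _).
    apply: etrans (esym (jac_compE d a fs idN ip jp lp)).
    by apply: eq_bigr => e _; exact: mulrC.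
  apply: eq_bigr => d _; rewrite -scaler_suml; congr (_ *: _).
  exact: (jac_compE d a idM fs ip kp lp).
rewrite exchange_big; apply: eq_bigr => e _ /=; rewrite scaler_sumr.
by apply: eq_bigr => d _; rewrite scalerA mulrC.
Qed.

Lemma smooth_at_tractor_conn (M : symplectic R n) k i a p :
  dom k p -> dom i p -> smooth_at (fun q => @tractor_conn M k i q a) p.
Proof.
move=> kp ip; apply: smooth_mx_sum => d _; apply: smooth_mxZ.
  exact/smooth_at_coord/(smooth_at_jac (smooth_map_id M)).
by apply: smooth_at_tract => //; exact: smooth_at_schouten1.
Qed.

Lemma tractor_conn_is_connection (M : symplectic R n) :
  is_connection (@tractor_conn M).
Proof.
split=> [k i a|]; last exact: (tractor_conn_parallel (id_morphism M)).
by apply: csmoothP => p [kp ip]; exact: smooth_at_tractor_conn.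
Qed.

(** Functoriality is the chain rule for Jacobians, carried over by [extend_mx]. *)
Lemma tractor_natural : natural tractor_conn.
Proof.
split=> [M|]; first by split; [exact: tractor_is_vbundle|exact: tractor_conn_is_connection].
exists tractor_map; split=> [M N f fm|//|M N P f g fm gm k l q p kp lp qp].
  have fs : smooth_map f by case: fm.
  split; last exact: tractor_conn_parallel.
  split=> [k l|k l p kp lp|k k' l l' p kp kp' lp lp'] /=.
  - by apply: csmoothP => p [kp lp]; apply/smooth_at_extend/(smooth_at_jac fs).
  - exact/extend_mx_unit/(jac_unit fm).
  - have E1 := jac_comp (smooth_map_id M) fs kp kp' lp'.
    have E2 := jac_comp fs (smooth_map_id N) kp lp lp'.
    have := congr1 extend_mx (etrans (esym E1) E2).
    by rewrite 2!extend_mxM.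
rewrite /tractor_map -extend_mxM.
have fs : smooth_map f by case: fm.
have gs : smooth_map g by case: gm.
exact: (congr1 extend_mx (jac_comp fs gs kp lp qp)).
Qed.

End Tractor.

Lemma ord2_ind (P : 'I_2 -> Prop) : P 0 -> P 1 -> forall k, P k.
Proof.
by move=> P0 P1 [[|[|//]] k]; [move: P0|move: P1]; congr P; apply: val_inj.
Qed.

Lemma matrix2P (T : Type) (A B : 'M[T]_2) :
  A 0 0 = B 0 0 -> A 0 1 = B 0 1 -> A 1 0 = B 1 0 -> A 1 1 = B 1 1 -> A = B.
Proof.
by move=> *; apply/matrixP; apply: ord2_ind; apply: ord2_ind.
Qed.

(** * Curvature of the tractor connection *)

Section TwoColumnsProducts.
Context {R : comPzRingType} {r : nat}.
Implicit Types (u v : 'cV[R]_r) (x y : 'rV[R]_r) (s t : R).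

Lemma rows2_cols2E00 x y u v : (rows2 x y *m cols2 u v) 0 0 = (x *m u) 0 0.
Proof. by rewrite mxE [RHS]mxE; apply: eq_bigr => k _; rewrite rows2E0 cols2E0. Qed.

Lemma rows2_cols2E01 x y u v : (rows2 x y *m cols2 u v) 0 1 = (x *m v) 0 0.
Proof. by rewrite mxE [RHS]mxE; apply: eq_bigr => k _; rewrite rows2E0 cols2E1. Qed.

Lemma rows2_cols2E10 x y u v : (rows2 x y *m cols2 u v) 1 0 = (y *m u) 0 0.
Proof. by rewrite mxE [RHS]mxE; apply: eq_bigr => k _; rewrite rows2E1 cols2E0. Qed.

Lemma rows2_cols2E11 x y u v : (rows2 x y *m cols2 u v) 1 1 = (y *m v) 0 0.
Proof. by rewrite mxE [RHS]mxE; apply: eq_bigr => k _; rewrite rows2E1 cols2E1. Qed.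

Let delta10E s (k l : 'I_2) :
  (s *: delta_mx 1 0 : 'M[R]_2) k l = s * ((k == 1) && (l == 0))%:R.
Proof. by rewrite !mxE. Qed.

Lemma cols2_delta u v s : cols2 u v *m (s *: delta_mx 1 0) = cols2 (s *: v) 0.
Proof.
apply/matrixP => c k; rewrite mxE (bigD1 1)//= big1 ?addr0 => [|l l1]; last first.
  by rewrite delta10E (negPf l1) !mulr0.
rewrite delta10E cols2E1; elim/ord2_ind: k.
  by rewrite cols2E0 mulr1 mxE mulrC.
by rewrite cols2E1 !mulr0 mxE.
Qed.

Lemma delta_rows2 x y s : (s *: delta_mx 1 0) *m rows2 x y = rows2 0 (s *: x).
Proof.
apply/matrixP => k c; rewrite mxE (bigD1 0)//= big1 ?addr0 => [|l l1]; last first.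
  by rewrite delta10E (negPf l1) andbF mulr0 mul0r.
rewrite delta10E rows2E0; elim/ord2_ind: k.
  by rewrite rows2E0 mulr0 mul0r mxE.
by rewrite rows2E1 mulr1 mxE.
Qed.

Lemma delta10_delta10 s t : (s *: delta_mx 1 0 : 'M[R]_2) *m (t *: delta_mx 1 0) = 0 :> 'M[R]_2.
Proof. by rewrite -scalemxAl -scalemxAr mul_delta_mx_0// !scaler0. Qed.

End TwoColumnsProducts.

(** The dual connection form - A^T has curvature minus the transpose; [X] and [Y] stand for the two
    derivatives in the curvature. *)
Lemma dual_curvature_algebra (R : comPzRingType) r (X Y A B : 'M[R]_r) :
  - X^T - - Y^T + - A^T *m - B^T - - B^T *m - A^T = - (X - Y + A *m B - B *m A)^T.
Proof.
have NN (C D : 'M[R]_r) : - C^T *m - D^T = (D *m C)^T.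
  by rewrite mulNmx mulmxN opprK trmx_mul.
rewrite !NN; move: (A *m B) (B *m A) => P Q.
by apply/matrixP => u v; rewrite !mxE; ring.
Qed.

(** * Symmetries of the curvature of a symplectic connection *)

Section Pointwise.
Context {R : realType} {n : nat} (M : symplectic R n).
Notation m := (2 * n)%N.
Variable i : chart M.
Implicit Types (p q : M) (a b c d : 'I_m).

(* Lam i p c d is Phi_d^c. *)
Definition Lam p := Jup i p *m Rho i p.

Lemma smooth_at_Lam p : dom i p -> smooth_at Lam p.
Proof. by move=> ip; apply: smooth_mxM; [exact: smooth_at_Jup|exact: smooth_at_Rho]. Qed.

Lemma dpart_J p a : dom i p ->
  dpart i a (J i) p = (gam i p a)^T *m J i p + J i p *m gam i p a.
Proof.
move=> ip; apply/matrixP => b c; have := @nabla_J _ _ M i p a b c ip.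
rewrite /christoffel -/(gam i p a).
move=> /eqP; rewrite subr_eq add0r subr_eq => /eqP ->.
rewrite addrC [RHS]mxE; congr (_ + _); rewrite [RHS]mxE; apply: eq_bigr => d _.
  by rewrite [in RHS]mxE.
exact: mulrC.
Qed.

Lemma gam_sym p a b c : dom i p -> gam i p a c b = gam i p b c a.
Proof. by move=> ip; exact: (@nabla_torsion_free _ _ M i p a b c ip). Qed.

Lemma gam_delta p a b : dom i p ->
  gam i p a *m delta_mx b 0 = gam i p b *m delta_mx a 0 :> 'cV[R]_m.
Proof.
by move=> ip; rewrite -!colE; apply/matrixP => c k; rewrite !mxE gam_sym.
Qed.

(** The sign arises because [Jup] inverts the transpose of J, which is - J. *)
Lemma Jup_J p : dom i p -> Jup i p *m J i p = - 1%:M.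
Proof.
move=> ip; have Ju : (J i p)^T \in unitmx by rewrite unitmx_tr J_nondegenerate.
by rewrite -[J i p]opprK -J_skew// mulmxN mulVmx.
Qed.

Lemma J_Jup p : dom i p -> J i p *m Jup i p = - 1%:M.
Proof.
move=> ip; have Ju : (J i p)^T \in unitmx by rewrite unitmx_tr J_nondegenerate.
by rewrite -[J i p]opprK -J_skew// mulNmx mulmxV.
Qed.

Lemma J_Lam p : dom i p -> J i p *m Lam p = - Rho i p.
Proof. by move=> ip; rewrite mulmxA J_Jup// mulNmx mul1mx. Qed.

(* J intertwines nabla on TM with the dual connection on 1-forms. *)
Lemma curv_gam_J p a b : dom i p ->
  J i p *m curv i (gam i) a b p = - (curv i (gam i) a b p)^T *m J i p.
Proof.
move=> ip; have sG c : smooth_at (fun q => gam i q c) p by exact: smooth_at_gam.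
have sGT c : smooth_at (fun q => - (gam i q c)^T) p by apply/smooth_mxN/smooth_mxT.
rewrite -(@curv_intertwine _ _ _ i _ _ (gam i) (fun q c => - (gam i q c)^T) (J i)
  a b p (dom i) ip (dom_open i) ip (smooth_at_J ip) sG sGT); last first.
  by move=> q c iq; rewrite dpart_J// mulNmx addrC addKr.
congr (_ *m _); rewrite !curvE.
rewrite !dpart_mxN ?dpart_mxT//; try exact: smooth_mxT.
exact: dual_curvature_algebra.
Qed.

(** By [curv_gam_J], J conjugates the curvature into minus its transpose, so the trace equals its
    own negative. *)
Lemma trace_curv_gam p a b : dom i p -> \tr (curv i (gam i) a b p) = 0.
Proof.
move=> ip; have JE := curv_gam_J a b ip; move: (curv _ _ _ _ _) JE => F JE.
have E : \tr F = - \tr F.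
  have Ju := J_nondegenerate ip.
  rewrite -{1}(mulKmx Ju F) JE mulNmx mulmxN linearN /= mxtrace_mulC -mulmxA mulmxV//.
  by rewrite mulmx1 mxtrace_tr.
have : \tr F *+ 2 = 0 by rewrite mulr2n {1}E addNr.
by move/eqP; rewrite mulrn_eq0 /= => /eqP.
Qed.

(** Torsion-freeness lets the form index of [gam] change places with its column index, both in the
    derivatives and in the products; the terms then cancel in pairs. *)
Lemma first_bianchi p a b d c : dom i p ->
  curv i (gam i) a b p c d + curv i (gam i) b d p c a + curv i (gam i) d a p c b = 0.
Proof.
move=> ip.
pose D e f g := dpart i e (gam i ^~ f) p c g.
pose P e f g := (gam i p e *m gam i p f) c g.
have DE e f g : D e f g = D e g f.
  rewrite /D !dpart_mxE//; try exact: smooth_at_gam.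
  by apply: (dpart_eq e ip (dom_open i) ip) => q iq; exact: gam_sym.
have PE e f g : P e f g = P e g f.
  by rewrite /P mxE [RHS]mxE; apply: eq_bigr => k _; rewrite (gam_sym f g).
have E e f g : curv i (gam i) e f p c g = D e f g - D f e g + P e f g - P f e g.
  by rewrite curvE 3![in LHS]mxE; congr (_ + _ + _ + _); rewrite [LHS]mxE.
rewrite !{}E; clearbody D P.
rewrite (DE a d b) (DE b d a) (DE d b a) (PE a d b) (PE b d a) (PE d b a); ring.
Qed.

Lemma curv_skew {r} (A : M -> 'I_m -> 'M[R]_r) a b p : curv i A a b p = - curv i A b a p.
Proof. by rewrite !curvE !opprD !opprK addrAC [in RHS]addrC !addrA; mx_abel. Qed.

(** The trace of the first Bianchi identity equates the skew part of the Ricci tensor with a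
    multiple of the trace of the curvature, which vanishes because [nabla] preserves J. *)
Lemma ric_sym p : dom i p -> (ric i p)^T = ric i p.
Proof.
move=> ip; apply/matrixP => d b; rewrite mxE [LHS]mxE [RHS]mxE.
apply/eqP; rewrite -subr_eq0 -sumrB; apply/eqP.
transitivity (- \tr (curv i (gam i) b d p)); last by rewrite trace_curv_gam// oppr0.
rewrite /mxtrace -sumrN; apply: eq_bigr => a _.
have := first_bianchi a b d a ip.
have -> : curv i (gam i) d a p a b = - curv i (gam i) a d p a b.
  by rewrite curv_skew [LHS]mxE.
by move=> /eqP; rewrite addrAC addr_eq0 => /eqP.
Qed.

Lemma Rho_sym p : dom i p -> (Rho i p)^T = Rho i p.
Proof. by move=> ip; rewrite /Rho linearZ /= ric_sym. Qed.

End Pointwise.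

(** * Block decomposition of the tractor curvature *)

Section CurvBlocks.
Context {R : realType} {n : nat} (M : symplectic R n).
Notation m := (2 * n)%N.
Variable i : chart M.
Implicit Types (p q : M) (a b c d : 'I_m).

Lemma smooth_at_cols2 {r} (f g : M -> 'cV[R]_r) p :
  smooth_at f p -> smooth_at g p -> smooth_at (fun q => cols2 (f q) (g q)) p.
Proof. exact: (@smooth_at_row_mx _ _ M _ 1 1). Qed.

Lemma smooth_at_rows2 {r} (f g : M -> 'rV[R]_r) p :
  smooth_at f p -> smooth_at g p -> smooth_at (fun q => rows2 (f q) (g q)) p.
Proof. exact: (@smooth_at_col_mx _ _ M 1 _ 1). Qed.

Lemma dpart_cols2 {r} a (f g : M -> 'cV[R]_r) p : dom i p ->
  smooth_at f p -> smooth_at g p ->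
  dpart i a (fun q => cols2 (f q) (g q)) p = cols2 (dpart i a f p) (dpart i a g p).
Proof. exact: (@dpart_row_mx _ _ M _ 1 1). Qed.

Lemma dpart_rows2 {r} a (f g : M -> 'rV[R]_r) p : dom i p ->
  smooth_at f p -> smooth_at g p ->
  dpart i a (fun q => rows2 (f q) (g q)) p = rows2 (dpart i a f p) (dpart i a g p).
Proof. exact: (@dpart_col_mx _ _ M 1 _ 1). Qed.

Lemma dpart_row {r s} a (b : 'I_r) (f : M -> 'M[R]_(r, s)) p : dom i p -> smooth_at f p ->
  dpart i a (fun q => row b (f q)) p = row b (dpart i a f p).
Proof.
move=> ip sf; apply/matrixP => u v; rewrite [RHS]mxE !dpart_mxE//; last exact: smooth_at_row.
by congr (dpart i a _ p); apply/funext => q; rewrite mxE.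
Qed.

Lemma dpart_col {r s} a (b : 'I_s) (f : M -> 'M[R]_(r, s)) p : dom i p -> smooth_at f p ->
  dpart i a (fun q => col b (f q)) p = col b (dpart i a f p).
Proof.
move=> ip sf; apply/matrixP => u v; rewrite [RHS]mxE !dpart_mxE//; last exact: smooth_at_col.
by congr (dpart i a _ p); apply/funext => q; rewrite mxE.
Qed.

Variable S : M -> 'I_m -> R.
Hypothesis sS : forall p a, dom i p -> smooth_at (S ^~ a) p.

(* The entries TM -> TM, s -> TM, TM -> r and s -> r of the curvature of D. *)
Definition curvXX p a b : 'M[R]_m := curv i (gam i) a b p +
  (col a (Lam i p) *m row b (J i p) - delta_mx a 0 *m row b (Rho i p)) -
  (col b (Lam i p) *m row a (J i p) - delta_mx b 0 *m row a (Rho i p)).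

Definition curvXs p a b : 'cV[R]_m :=
  col b (dpart i a (Lam i) p) - col a (dpart i b (Lam i) p)
  + (gam i p a *m col b (Lam i p) + S p b *: delta_mx a 0)
  - (gam i p b *m col a (Lam i p) + S p a *: delta_mx b 0).

Definition curvrX p a b : 'rV[R]_m :=
  - row b (dpart i a (Rho i) p) + row a (dpart i b (Rho i) p)
  + (- row a (Rho i p) *m gam i p b + S p a *: row b (J i p))
  - (- row b (Rho i p) *m gam i p a + S p b *: row a (J i p)).

Definition curvrs p a b : R :=
  dpart i a (S ^~ b) p - dpart i b (S ^~ a) p
  - (row a (Rho i p) *m col b (Lam i p)) 0 0
  + (row b (Rho i p) *m col a (Lam i p)) 0 0.

Lemma dpart_tract p a b : dom i p ->
  dpart i a (fun q => tract i S q b) p =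
  block_mx (dpart i a (gam i ^~ b) p)
    (cols2 (col b (dpart i a (Lam i) p)) 0)
    (rows2 (row b (dpart i a (J i) p)) (- row b (dpart i a (Rho i) p)))
    (dpart i a (S ^~ b) p *: delta_mx 1 0).
Proof.
move=> ip.
have sL := smooth_at_Lam ip; have sR := smooth_at_Rho ip; have sJ := smooth_at_J ip.
have sD : smooth_at (fun q => delta_mx b 0 : 'cV[R]_m) p by exact: smooth_at_cst.
have sd : smooth_at (fun q => delta_mx 1 0 : 'M[R]_2) p by exact: smooth_at_cst.
have sRb := smooth_at_row b sR; have sJb := smooth_at_row b sJ.
have sLb := smooth_at_col b sL; have sSb := sS b ip.
rewrite dpart_block_mx//; first congr block_mx.
- rewrite (dpart_cols2 a ip sLb sD) dpart_cst.
  by rewrite (dpart_col a b ip sL).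
- rewrite (dpart_rows2 a ip sJb (smooth_mxN sRb)) (dpart_row a b ip sJ).
  by rewrite dpart_mxN// (dpart_row a b ip sR).
- by rewrite dpart_mxZ// dpart_cst scaler0 addr0.
- exact: smooth_at_gam.
- exact: smooth_at_cols2.
- by apply: smooth_at_rows2 => //; exact: smooth_mxN.
- exact: smooth_mxZ.
Qed.

Lemma row_mul_col {r s} (A : 'M[R]_(r, s)) (B : 'M[R]_(s, r)) (a b : 'I_r) :
  (row a A *m col b B) 0 0 = (A *m B) a b.
Proof. by rewrite mxE [RHS]mxE; apply: eq_bigr => k _; rewrite !mxE. Qed.

Lemma J_Lam_entry p a b : dom i p ->
  (row a (J i p) *m col b (Lam i p)) 0 0 = - Rho i p a b.
Proof. by move=> ip; rewrite row_mul_col J_Lam// mxE. Qed.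

Lemma row_delta_entry {r s} (A : 'M[R]_(r, s)) (a : 'I_r) (b : 'I_s) : 
  (row a A *m (delta_mx b 0 : 'cV[R]_s)) 0 0 = A a b.
Proof. by rewrite -colE !mxE. Qed.

Lemma J_skew_entry p a b : dom i p -> J i p b a = - J i p a b.
Proof. by move=> ip; have /matrixP/(_ a b) := J_skew ip; rewrite !mxE. Qed.

Lemma Rho_sym_entry p a b : dom i p -> Rho i p b a = Rho i p a b.
Proof. by move=> ip; have /matrixP/(_ a b) := Rho_sym ip; rewrite [LHS]mxE. Qed.

(** Entry r -> TM vanishes by torsion-freeness, TM -> s by [nabla] J = 0 together with
    torsion-freeness, s -> s and r -> r by the symmetry of [Rho]. The skewness of J doubles the
    entry r -> s. *)
Lemma curv_tract p a b : dom i p ->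
  curv i (tract i S) a b p =
  block_mx (curvXX p a b) (cols2 (curvXs p a b) 0) (rows2 0 (curvrX p a b))
    ((2 * J i p a b) *: delta_mx 0 1 + curvrs p a b *: delta_mx 1 0).
Proof.
move=> ip; rewrite curvE !dpart_tract// /tract -/(Lam i p).
rewrite !mulmx_block !(opp_block_mx, add_block_mx); congr block_mx.
- rewrite !mulmx_cols2_rows2 /curvXX curvE !mulmxN.
  mx_abel.
- rewrite !mulmx_cols2 !cols2_delta !(opp_cols2, add_cols2) /curvXs.
  by congr cols2; rewrite ?subrr ?addr0 ?add0r ?oppr0// gam_delta// addrN.
- rewrite !mulmx_rows2 !delta_rows2 !(opp_rows2, add_rows2) /curvrX.
  congr rows2; last by rewrite opprK.
  rewrite !addr0 -!row_mul !dpart_J// !linearD /=.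
  have -> : row b ((gam i p a)^T *m J i p) = row a ((gam i p b)^T *m J i p).
    apply/matrixP => u d; rewrite !mxE; apply: eq_bigr => e _.
    by rewrite !mxE gam_sym.
  move: (row a ((gam i p b)^T *m J i p)) (row b (J i p *m gam i p a))
    (row a (J i p *m gam i p b)) => X Y Z.
  by apply/matrixP => u v; rewrite !mxE; ring.
- rewrite !delta10_delta10 !addr0.
  have EL (P Q : 'M[R]_2) (x y : R) k l :
      (x *: delta_mx 1 0 - y *: delta_mx 1 0 + P - Q) k l =
      (x - y) * ((k == 1) && (l == 0))%:R + P k l - Q k l.
    by rewrite !mxE; ring.
  have ER (x y : R) (k l : 'I_2) :
      (x *: delta_mx 0 1 + y *: delta_mx 1 0 : 'M[R]_2) k l =
      x * ((k == 0) && (l == 1))%:R + y * ((k == 1) && (l == 0))%:R.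
    by rewrite !mxE.
  apply: matrix2P; rewrite EL ER ?rows2_cols2E00 ?rows2_cols2E01 ?rows2_cols2E10
    ?rows2_cols2E11 /= ?mulr1 ?mulr0.
  + by rewrite !J_Lam_entry// (Rho_sym_entry a b)//; ring.
  + by rewrite !row_delta_entry (J_skew_entry a b)//; ring.
  + rewrite /curvrs !mulNmx; move: (row a _ *m _) (row b _ *m _) => P Q.
    by rewrite !mxE; ring.
  + rewrite !mulNmx; have := row_delta_entry (Rho i p) a b.
    have := row_delta_entry (Rho i p) b a.
    have := Rho_sym_entry a b ip; move: (Rho i p a b) (Rho i p b a) => x y.
    move: (row a _ *m _) (row b _ *m _) => P Q -> EQ EP.
    by rewrite !mxE EP EQ; ring.
Qed.

End CurvBlocks.

(** * Traces of the curvature and the determination of Phi *)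

Lemma mxtrace_skew_sym (R : numDomainType) r (A B : 'M[R]_r) :
  A^T = - A -> B^T = B -> \tr (A *m B) = 0.
Proof.
move=> AT BT; have E : \tr (A *m B) = - \tr (A *m B).
  by rewrite -{1}mxtrace_tr trmx_mul AT BT mulmxN linearN /= mxtrace_mulC.
have : \tr (A *m B) *+ 2 = 0 by rewrite mulr2n {1}E addNr.
by move/eqP; rewrite mulrn_eq0 /= => /eqP.
Qed.

Section Traces.
Context {R : realType} {n : nat} (M : symplectic R n).
Notation m := (2 * n)%N.
Variable i : chart M.
Implicit Types (p q : M) (a b c d e : 'I_m).

Lemma Jup_skew p : dom i p -> (Jup i p)^T = - Jup i p.
Proof.
move=> ip; apply: (can_inj (mulKmx (J_nondegenerate ip))).
rewrite mulmxN J_Jup// opprK -[J i p]opprK -J_skew// mulNmx -trmx_mul Jup_J//.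
by rewrite linearN /= trmx1 opprK.
Qed.

Lemma trace_Lam p : dom i p -> \tr (Lam i p) = 0.
Proof. by move=> ip; apply: mxtrace_skew_sym; [exact: Jup_skew|exact: Rho_sym]. Qed.

Lemma LamE p b c : dom i p -> Lam i p c b = \sum_e Rho i p b e * Jup i p c e.
Proof.
move=> ip; rewrite mxE; apply: eq_bigr => e _.
by rewrite (Rho_sym_entry b e ip) mulrC.
Qed.

Lemma curvXXE p a b c d : dom i p -> curvXX i p a b c d =
  curv i (gam i) a b p c d
  + (Lam i p c a * J i p b d - (a == c)%:R * Rho i p b d)
  - (Lam i p c b * J i p a d - (b == c)%:R * Rho i p a d).
Proof.
move=> ip.
have E (f : 'I_m) (A B : 'M[R]_m) g : (col f A *m row g B) c d = A c f * B g d.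
  by rewrite mxE big_ord1 !mxE.
have E' (f : 'I_m) (B : 'M[R]_m) g :
    ((delta_mx f 0 : 'cV[R]_m) *m row g B) c d = (f == c)%:R * B g d.
  by rewrite mxE big_ord1 !mxE eqxx andbT eq_sym.
rewrite /curvXX -!(E, E'); move: (_ *m _) (_ *m _) (_ *m _) (_ *m _) (curv _ _ _ _ _).
by move=> *; rewrite !mxE.
Qed.

(** The corrections in [curvXX] are all the terms of [curvature_form] but the last, which is 2 J_ab
    [Lam]; so the two differences coincide entry by entry. *)
Lemma curvXX_curvature_form p a b : dom i p ->
  curvXX i p a b = (2 * J i p a b) *: Lam i p <->
  (forall c d, curv i (gam i) a b p c d = curvature_form (@Rho _ _ M) i p a b c d).
Proof.
move=> ip.
have E c d : curvXX i p a b c d - (2 * J i p a b) * Lam i p c d =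
    curv i (gam i) a b p c d - curvature_form (@Rho _ _ M) i p a b c d.
  by rewrite curvXXE// /curvature_form -!LamE//; ring.
split=> [XE c d|cE].
  by apply/eqP; rewrite -subr_eq0 -E XE [X in X - _]mxE subrr.
apply/matrixP => c d; apply/eqP; rewrite [X in _ == X]mxE -subr_eq0 E cE.
by rewrite subrr.
Qed.

Lemma trJ_Lam p : dom i p -> (J i p)^T *m Lam i p = Rho i p.
Proof. by move=> ip; rewrite J_skew// mulNmx J_Lam// opprK. Qed.

Lemma trace_curvXX p b d : dom i p -> \sum_a curvXX i p a b a d = ric i p b d - m%:R * Rho i p b d.
Proof.
move=> ip; under eq_bigr do rewrite curvXXE//.
rewrite sumrB big_split /= sumrB -mulr_suml -[\sum_a Lam i p a a]/(\tr (Lam i p)).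
rewrite trace_Lam// mul0r sumrB.
have -> : \sum_a Lam i p a b * J i p a d = Rho i p b d.
  rewrite (Rho_sym_entry d b ip) -(trJ_Lam ip) mxE.
  by apply: eq_bigr => a _; rewrite [X in _ = X * _]mxE mulrC.
have -> : \sum_a (b == a)%:R * Rho i p a d = Rho i p b d.
  rewrite (bigD1 b)//= eqxx mul1r big1 ?addr0// => a; rewrite eq_sym => /negPf ->.
  exact: mul0r.
under [X in _ + (_ - X) - _]eq_bigr do rewrite eqxx mul1r.
rewrite sumr_const card_ord subrr subr0 sub0r -[_ *+ _]mulr_natl; congr (_ - _).
by rewrite [RHS]mxE.
Qed.

Lemma ricE p : ric i p = (2 * n + 2)%:R *: Rho i p.
Proof. by rewrite /Rho scalerA mulfV ?scale1r// pnatr_eq0 addn2. Qed.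

Lemma curvXX_proportional p (K : 'M[R]_m) : dom i p ->
  (forall a b, curvXX i p a b = J i p a b *: K) ->
  forall a b, curvXX i p a b = (2 * J i p a b) *: Lam i p.
Proof.
move=> ip XK a b.
(* On the left stands the trace of J_ab [K] over a = c; on the right, (2n+2) - 2n = 2 copies of
   [Rho]. Inverting J then determines [K]. *)
have JK : (J i p)^T *m K = 2 *: Rho i p.
  apply/matrixP => b' d; have := trace_curvXX b' d ip; rewrite ricE [X in X - _]mxE -mulrBl.
  rewrite [in X in X - _]natrD addrAC subrr add0r => E; rewrite [RHS]mxE -E mxE.
  by apply: eq_bigr => a' _; rewrite XK [RHS]mxE [X in X * _ = _]mxE.
have Ju : (J i p)^T \in unitmx by rewrite unitmx_tr J_nondegenerate.
rewrite XK mulrC -scalerA; congr (_ *: _).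
by rewrite -(mulKmx Ju K) JK -scalemxAr.
Qed.

(** Origin of the factor 2n+2: over a = c the five terms of the form have traces 2n, -1, 1, 0 and 2
    times Phi_bd, the fourth because Phi_a^a = 0. *)
Lemma curvature_form_Rho p (Phi : chart M -> M -> 'M[R]_m) : dom i p ->
  (Phi i p)^T = Phi i p ->
  (forall a b c d, curv i (gam i) a b p c d = curvature_form Phi i p a b c d) ->
  Phi i p = Rho i p.
Proof.
move=> ip PT cE; pose L := Jup i p *m Phi i p.
have PTE b d : Phi i p d b = Phi i p b d by move/matrixP/(_ b d): PT; rewrite mxE.
have LE b c : L c b = \sum_e Phi i p b e * Jup i p c e.
  by rewrite mxE; apply: eq_bigr => e _; rewrite PTE mulrC.
have trL : \tr L = 0 by apply: mxtrace_skew_sym => //; exact: Jup_skew.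
have JL : (J i p)^T *m L = Phi i p.
  by rewrite J_skew// mulNmx mulmxA J_Jup// mulNmx mul1mx opprK.
have JLE b d : \sum_a J i p a b * L a d = Phi i p b d.
  by rewrite -JL [RHS]mxE; apply: eq_bigr => a _; rewrite [X in _ = X * _]mxE.
suff E : ric i p = (2 * n + 2)%:R *: Phi i p.
  by rewrite /Rho E scalerA mulVf ?scale1r// pnatr_eq0 addn2.
apply/matrixP => b d; rewrite [LHS]mxE [RHS]mxE.
transitivity (\sum_a (Phi i p b d - (b == a)%:R * Phi i p a d +
    J i p a d * L a b - L a a * J i p b d + 2 * (J i p a b * L a d))).
  apply: eq_bigr => a _; rewrite cE /curvature_form eqxx -!LE mul1r; ring.
rewrite big_split /= -mulr_sumr JLE sumrB big_split /= JLE -mulr_suml.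
rewrite -[\sum_a L a a]/(\tr L) trL sumrB sumr_const card_ord.
have -> : \sum_a (b == a)%:R * Phi i p a d = Phi i p b d.
  rewrite (bigD1 b)//= eqxx mul1r big1 ?addr0// => a; rewrite eq_sym => /negPf ->.
  exact: mul0r.
by rewrite (PTE b d) -mulr_natl natrD; ring.
Qed.

End Traces.

(** * Consequences of the Bianchi identity *)

Section Submatrices.
Context {R : realType} {l : nat} (M : manifold R l) (i : chart M).
Context {r s t u : nat}.
Implicit Types (f : M -> 'M[R]_(r + s, t + u)).

Lemma dpart_ulsubmx a f p : dom i p -> smooth_at f p ->
  ulsubmx (dpart i a f p) = dpart i a (fun q => ulsubmx (f q)) p.
Proof.
move=> ip sf; apply/matrixP => v w; rewrite dpart_mxE//; last first.
  apply/smooth_at_mxP => v' w'.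
  under [X in smooth_at X]funext do rewrite !mxE.
  exact: smooth_at_coord.
rewrite 2![LHS]mxE dpart_mxE//; congr (dpart i a _ p); apply/funext => q.
by rewrite !mxE.
Qed.

Lemma dpart_ursubmx a f p : dom i p -> smooth_at f p ->
  ursubmx (dpart i a f p) = dpart i a (fun q => ursubmx (f q)) p.
Proof.
move=> ip sf; apply/matrixP => v w; rewrite dpart_mxE//; last exact: smooth_at_ursubmx.
rewrite 2![LHS]mxE dpart_mxE//; congr (dpart i a _ p); apply/funext => q.
by rewrite !mxE.
Qed.

End Submatrices.

Section Codazzi.
Context {R : realType} {n : nat} (M : symplectic R n).
Notation m := (2 * n)%N.
Variable i : chart M.
Implicit Types (p q : M) (a b c d e : 'I_m).

Definition dLam p a : 'M[R]_m :=
  dpart i a (Lam i) p + gam i p a *m Lam i p - Lam i p *m gam i p a.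

Definition dRho p a : 'M[R]_m :=
  dpart i a (Rho i) p - (gam i p a)^T *m Rho i p - Rho i p *m gam i p a.

(** Differentiate J [Lam] = - [Rho]: since [nabla] J = 0, lowering the index commutes with covariant
    differentiation. *)
Lemma J_dLam p a : dom i p -> J i p *m dLam p a = - dRho p a.
Proof.
move=> ip; have sL := smooth_at_Lam ip; have sJ := smooth_at_J ip.
have := dpart_eq a ip (dom_open i) ip (fun q iq => J_Lam iq).
rewrite dpart_mxM// dpart_mxN//; last exact: smooth_at_Rho.
rewrite dpart_J// => E.
rewrite /dLam mulmxBr mulmxDr [X in _ - X]mulmxA J_Lam// /dRho.
move: E; rewrite mulmxDl -!mulmxA J_Lam//.
move: (dpart i a (Rho i) p) (J i p *m dpart _ _ _ _) => X Y.
rewrite mulmxN !mulNmx; move: (J i p *m _) (_^T *m _) (Rho i p *m _) => A B C E.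
have -> : Y = - X + B - A by rewrite -E; apply/matrixP => u v; rewrite !mxE; ring.
by apply/matrixP => u v; rewrite !mxE; ring.
Qed.

Lemma dRho_sym p a : dom i p -> (dRho p a)^T = dRho p a.
Proof.
move=> ip; have sR := smooth_at_Rho ip.
rewrite /dRho !linearB /= -dpart_mxT// !trmx_mul trmxK Rho_sym//.
rewrite (dpart_eq a ip (dom_open i) ip (fun q iq => Rho_sym iq)).
by rewrite addrAC.
Qed.

Lemma trace_dLam p a : dom i p -> \tr (dLam p a) = 0.
Proof.
move=> ip; have -> : dLam p a = Jup i p *m dRho p a.
  rewrite -[dRho p a]opprK -J_dLam// mulmxN mulmxA Jup_J// mulNmx mul1mx opprK.
  by [].
by apply: mxtrace_skew_sym; [exact: Jup_skew|exact: dRho_sym].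
Qed.

Variable S : M -> 'I_m -> R.

(** The row index of [Rho] is here a form index. Its Christoffel terms, present in [dRho] but not in
    [curvrX], cancel by torsion-freeness. *)
Lemma curvrXE p a b d : dom i p -> curvrX i S p a b 0 d =
  dRho p b a d - dRho p a b d + (S p a * J i p b d - S p b * J i p a d).
Proof.
move=> ip.
have E e f (A B : 'M[R]_m) : (row e A *m B) 0 f = (A *m B) e f.
  by rewrite -row_mul mxE.
have G : ((gam i p a)^T *m Rho i p) b d = ((gam i p b)^T *m Rho i p) a d.
  rewrite mxE [RHS]mxE; apply: eq_bigr => e _.
  by rewrite [X in X * _]mxE [X in _ = X * _]mxE gam_sym.
rewrite /curvrX /dRho !mulNmx.
have := E a d (Rho i p) (gam i p b); have := E b d (Rho i p) (gam i p a); move: G.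
move: (_^T *m _) (_^T *m _) (row _ _ *m _) (row _ _ *m _) (Rho i p *m _)
  (Rho i p *m _) (dpart _ _ _ _) (dpart _ _ _ _) (J i p) => A B C D A' B' C' D' Jp.
by move=> EA EB EC; rewrite !mxE EB EC EA; ring.
Qed.

Lemma curvXsE p a b c : dom i p -> curvXs i S p a b c 0 =
  dLam p a c b - dLam p b c a + (S p b * (c == a)%:R - S p a * (c == b)%:R).
Proof.
move=> ip.
have E e f (A B : 'M[R]_m) : (A *m col f B) e 0 = (A *m B) e f.
  by rewrite mxE [RHS]mxE; apply: eq_bigr => k _; rewrite mxE.
have G : (Lam i p *m gam i p a) c b = (Lam i p *m gam i p b) c a.
  by rewrite mxE [RHS]mxE; apply: eq_bigr => e _; rewrite gam_sym.
rewrite /curvXs /dLam.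
have := E c b (gam i p a) (Lam i p); have := E c a (gam i p b) (Lam i p); move: G.
move: (dpart _ _ _ _) (dpart _ _ _ _) (Lam i p *m _) (Lam i p *m _)
  (gam i p a *m _) (gam i p b *m _) (gam i p a *m col _ _) (gam i p b *m col _ _)
  => C' D' A B A' B' C D.
by move=> EA EB EC; rewrite !mxE EB EC EA !eqxx !andbT; ring.
Qed.

(** D preserves the skew form s r' - r s' + J_bc X^b X'^c, so its curvature lies in the symplectic
    Lie algebra, where the entries s -> TM and TM -> r determine each other. *)
Lemma J_curvXs p a b d : dom i p -> (J i p *m curvXs i S p a b) d 0 = curvrX i S p a b 0 d.
Proof.
move=> ip; rewrite mxE; under eq_bigr do rewrite curvXsE// mulrDr 2!mulrBr.
rewrite big_split sumrB sumrB /=.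
have P e f : \sum_k J i p d k * dLam p e k f = - dRho p e d f.
  by have /matrixP/(_ d f) := J_dLam e ip; rewrite [LHS]mxE => ->; rewrite [LHS]mxE.
have Q e (x : R) : \sum_k J i p d k * (x * (k == e)%:R) = x * J i p d e.
  rewrite (bigD1 e)//= eqxx mulr1 big1 ?addr0; first exact: mulrC.
  by move=> k /negPf ->; rewrite !mulr0.
have D e f g : dRho p e f g = dRho p e g f.
  by rewrite -{1}(dRho_sym e ip) [LHS]mxE.
rewrite !P !Q curvrXE// (J_skew_entry a d ip) (J_skew_entry b d ip).
rewrite (D a b d) (D b a d); ring.
Qed.

Lemma curvrs_skew p a b : curvrs i S p b a = - curvrs i S p a b.
Proof. by rewrite /curvrs; ring. Qed.

End Codazzi.

Section RicciType.
Context {R : realType} {n : nat} (M : symplectic R n).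
Notation m := (2 * n)%N.
Variable i : chart M.
Implicit Types (p q : M) (a b c d e : 'I_m).
(** The required form of R, in the shape given by [curvXX_curvature_form]. It is assumed throughout
    the chart because the Bianchi identity differentiates it. *)
Hypothesis curvXXL : forall q a b, dom i q -> curvXX i q a b = (2 * J i q a b) *: Lam i q.

Lemma cyclic_dJ p a b c : dom i p ->
  dpart i a (fun q => J i q b c) p + dpart i b (fun q => J i q c a) p
  + dpart i c (fun q => J i q a b) p = 0.
Proof.
move=> ip; have sJ := smooth_at_J ip.
have := @J_closed _ _ M i p a b c ip.
apply: etrans; congr (_ + _ + _); apply: esym; exact: dpart_mxE.
Qed.

Lemma dpart_2J p e a b : dom i p ->
  dpart i e (fun q => 2 * J i q a b) p = 2 * dpart i e (fun q => J i q a b) p.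
Proof.
move=> ip; rewrite dpartM//; [|exact: smooth_at_cst|].
  by rewrite dpart_cst mul0r add0r.
by apply/smooth_at_coord/smooth_at_J.
Qed.

Lemma smooth_at_2J p a b : dom i p -> smooth_at (fun q => 2 * J i q a b) p.
Proof.
move=> ip; apply: smooth_atM; first exact: smooth_at_cst.
exact/smooth_at_coord/smooth_at_J.
Qed.

Section AnySchouten.
Variable S : M -> 'I_m -> R.
Hypothesis sS : forall p a, dom i p -> smooth_at (S ^~ a) p.

Lemma smooth_at_curv_tract p a b : dom i p -> smooth_at (curv i (tract i S) a b) p.
Proof.
by move=> ip; apply: smooth_at_curv => // c; apply: smooth_at_tract => //; exact: sS.
Qed.

Lemma bianchi_ul p e a b : dom i p ->
  ulsubmx (dpart i e (curv i (tract i S) a b) p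
    + tract i S p e *m curv i (tract i S) a b p
    - curv i (tract i S) a b p *m tract i S p e) =
  (2 * dpart i e (fun q => J i q a b) p) *: Lam i p + (2 * J i p a b) *: dLam i p e
  + delta_mx e 0 *m curvrX i S p a b - curvXs i S p a b *m row e (J i p).
Proof.
move=> ip.
have ulD (A B : 'M[R]_(m + 2)) : ulsubmx (A + B) = ulsubmx A + ulsubmx B.
  by apply/matrixP => u v; rewrite !mxE.
have ulN (A : 'M[R]_(m + 2)) : ulsubmx (- A) = - ulsubmx A.
  by apply/matrixP => u v; rewrite !mxE.
rewrite ulD ulN ulD dpart_ulsubmx//; last exact: smooth_at_curv_tract.
have -> : dpart i e (fun q => ulsubmx (curv i (tract i S) a b q)) p =
    (2 * dpart i e (fun q => J i q a b) p) *: Lam i p +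
    (2 * J i p a b) *: dpart i e (Lam i) p.
  rewrite (@dpart_eq _ _ _ _ i e _ (fun q => (2 * J i q a b) *: Lam i q) p (dom i))//.
  - rewrite dpart_mxZ// ?dpart_2J//; first exact: smooth_at_2J.
    exact: smooth_at_Lam.
  - exact: dom_open.
  - by move=> q iq; rewrite curv_tract// block_mxKul curvXXL.
rewrite curv_tract// /tract !mulmx_block !block_mxKul !mulmx_cols2_rows2 curvXXL//.
rewrite mulmx0 mul0mx add0r addr0 -scalemxAr -scalemxAl.
rewrite /dLam; move: (delta_mx e 0 *m _) (curvXs _ _ _ _ _ *m _) => A B.
move: (Lam i p) (dpart i e (Lam i) p) (Lam i p *m _) (gam i p e *m _) => C D E F.
by apply/matrixP => u v; rewrite !mxE; ring.
Qed.

(** The undifferentiated [Lam] has the cyclic sum of the derivatives of J as coefficient and drops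
    out because J is closed. *)
Lemma cyclic_ul p e a b c d : dom i p ->
  2 * J i p a b * dLam i p e c d + (c == e)%:R * curvrX i S p a b 0 d
    - curvXs i S p a b c 0 * J i p e d +
  (2 * J i p b e * dLam i p a c d + (c == a)%:R * curvrX i S p b e 0 d
    - curvXs i S p b e c 0 * J i p a d) +
  (2 * J i p e a * dLam i p b c d + (c == b)%:R * curvrX i S p e a 0 d
    - curvXs i S p e a c 0 * J i p b d) = 0.
Proof.
move=> ip.
have ulD (A B : 'M[R]_(m + 2)) : ulsubmx (A + B) = ulsubmx A + ulsubmx B.
  by apply/matrixP => u v; rewrite !mxE.
have := @second_bianchi _ _ M i _ (tract i S) e a b p ip (fun f =>
  smooth_at_tract ip (sS f ip)).
move=> /(congr1 (@ulsubmx _ m 2 m 2)); rewrite 2!ulD !bianchi_ul//.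
move=> /matrixP/(_ c d).
have E f (B : 'rV[R]_m) : ((delta_mx f 0 : 'cV[R]_m) *m B) c d = (c == f)%:R * B 0 d.
  by rewrite mxE big_ord1 !mxE eqxx andbT.
have E' f (A : 'cV[R]_m) : (A *m row f (J i p)) c d = A c 0 * J i p f d.
  by rewrite mxE big_ord1 [X in _ * X]mxE.
have := cyclic_dJ e a b ip; rewrite -!E -!E'.
move: (dpart i e _ p) (dpart i a _ p) (dpart i b _ p) => x y z xyz.
have {xyz} -> : z = - x - y by rewrite -[RHS]add0r -xyz; ring.
move: (delta_mx e 0 *m _) (delta_mx a 0 *m _) (delta_mx b 0 *m _)
  (_ *m row e _) (_ *m row a _) (_ *m row b _) (dLam i p e)
   (dLam i p a) (dLam i p b) (Lam i p) (J i p a b) (J i p b e) (J i p e a)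
   => A B C A' B' C' D1 D2 D3 L j1 j2 j3.
by rewrite !mxE => <-; ring.
Qed.

End AnySchouten.
End RicciType.

(** * The choice of S and the entries s -> TM, TM -> r and s -> r *)

Section RicciType.
Context {R : realType} {n : nat} (M : symplectic R n).
Notation m := (2 * n)%N.
Variable i : chart M.
Implicit Types (p q : M) (a b c d e : 'I_m).
Hypothesis curvXXL : forall q a b, dom i q -> curvXX i q a b = (2 * J i q a b) *: Lam i q.

(** With S = 0 the entries [curvXs] and [curvrX] are the bare skew derivative of Phi, and
    [schouten1] is built from the trace of the former. *)
Let S0 (p : M) (a : 'I_m) : R := 0.

Lemma sum_delta (f : 'I_m -> R) a : \sum_(e < m) (e == a)%:R * f e = f a.
Proof.
rewrite (bigD1 a)//= eqxx mul1r big1 ?addr0// => e /negPf ->.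
exact: mul0r.
Qed.

Lemma schouten1E p b : dom i p ->
  (2 * n + 1)%:R * schouten1 i p b = - \sum_(e < m) curvXs i S0 p e b e 0.
Proof.
move=> ip; rewrite /schouten1 mulrA mulrN mulfV ?pnatr_eq0 ?addn1// mulN1r.
congr (- _); apply: eq_bigr => e _; rewrite curv_tract//; last first.
  by move=> *; exact: smooth_at_cst.
by rewrite block_mxKur cols2E0.
Qed.

Lemma sum_curvXs p d : dom i p -> \sum_(e < m) curvXs i S0 p e d e 0 = \sum_(e < m) dLam i p e e d.
Proof.
move=> ip; under eq_bigr do rewrite curvXsE// !mul0r subrr addr0.
by rewrite sumrB -[X in _ - X]/(\tr (dLam i p d)) trace_dLam// subr0.
Qed.

(* Contract the upper index of the cyclic identity with the direction e of
   differentiation. *)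
Lemma traced_bianchi p a b d : dom i p ->
  (2 * n + 1)%:R * curvrX i S0 p a b 0 d =
  - 2 * J i p a b * (\sum_(e < m) curvXs i S0 p e d e 0)
  - J i p a d * (\sum_(e < m) curvXs i S0 p e b e 0)
  + J i p b d * (\sum_(e < m) curvXs i S0 p e a e 0).
Proof.
move=> ip; have sS0 q c : dom i q -> smooth_at (S0 ^~ c) q.
  by move=> _; exact: smooth_at_cst.
have := big1 (op := +%R) (index_enum 'I_m) xpredT _
  (fun e _ => @cyclic_ul _ _ M i curvXXL S0 sS0 p e a b e d ip).
rewrite 2!big_split /= !sumrB !big_split /= -mulr_sumr !sum_delta.
(* The coefficient 2n + 1 arises as 2n from this sum, 1 from the contraction of [curvXs] with J, 2
   from the derivatives of Phi contracted with J, and -2 from the two remaining delta terms. *)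
have -> : \sum_(e < m) (e == e)%:R * curvrX i S0 p a b 0 d = (2 * n)%:R * curvrX i S0 p a b 0 d.
  under eq_bigr do rewrite eqxx mul1r.
  by rewrite sumr_const card_ord mulr_natl.
have JD f g h : \sum_(e < m) J i p f e * dLam i p h e g = - dRho i p h f g.
  by have /matrixP/(_ f g) := J_dLam h ip; rewrite [LHS]mxE => ->; rewrite [LHS]mxE.
have -> : \sum_(e < m) curvXs i S0 p a b e 0 * J i p e d = - curvrX i S0 p a b 0 d.
  rewrite -J_curvXs// mxE -sumrN; apply: eq_bigr => e _.
  by rewrite (J_skew_entry d e ip) mulrN mulrC.
have -> : \sum_(e < m) 2 * J i p b e * dLam i p a e d = - 2 * dRho i p a b d.
  by under eq_bigr do rewrite -mulrA; rewrite -mulr_sumr JD; ring.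
have -> : \sum_(e < m) 2 * J i p e a * dLam i p b e d = 2 * dRho i p b a d.
  under eq_bigr do rewrite (J_skew_entry a _ ip) mulrN mulNr -mulrA.
  by rewrite sumrN -mulr_sumr JD; ring.
have ZS f g : curvrX i S0 p f g 0 d = dRho i p g f d - dRho i p f g d.
  by rewrite curvrXE// !mul0r subrr addr0.
have -> : \sum_(e < m) curvXs i S0 p b e e 0 * J i p a d =
    - (J i p a d * \sum_(e < m) curvXs i S0 p e b e 0).
  rewrite -mulr_suml mulrC -mulrN -sumrN; congr (_ * _); apply: eq_bigr => e _.
  by rewrite !curvXsE//; rewrite /S0; ring.
rewrite -mulr_suml -sum_curvXs//.
move: (\sum_(e < m) curvXs i S0 p e d e 0) (\sum_(e < m) curvXs i S0 p e b e 0) (\sum_(e < m) curvXs i S0 p e a e 0).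
move=> td tb ta; rewrite natrD !ZS; move: (2 * n)%:R => N.
move: (dRho i p a b d) (dRho i p b a d) => x y H.
by apply/eqP; rewrite -subr_eq0 -[X in _ == X]H; apply/eqP; ring.
Qed.

Local Notation S := (schouten1 i).

(** This is what the normalisation of S is made for: the traces in [traced_bianchi] equal - (2n+1)
    S, and its terms in J_ad S_b and J_bd S_a cancel against those which S adds to [curvrX]. *)
Lemma curvrX_schouten1 p a b d : dom i p ->
  curvrX i S p a b 0 d = 2 * J i p a b * S p d.
Proof.
move=> ip; have H := traced_bianchi a b d ip.
have E f : \sum_(e < m) curvXs i S0 p e f e 0 = - ((2 * n + 1)%:R * S p f).
  by rewrite schouten1E// opprK.
have N0 : (2 * n + 1)%:R != 0 :> R by rewrite pnatr_eq0 addn1.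
apply: (mulfI N0); rewrite !E in H; rewrite curvrXE// mulrDr.
have -> : (2 * n + 1)%:R * (dRho i p b a d - dRho i p a b d) =
    (2 * n + 1)%:R * curvrX i S0 p a b 0 d.
  by rewrite curvrXE// !mul0r subrr addr0.
rewrite H; move: (S p a) (S p b) (S p d) => x y z; ring.
Qed.

(* J_bc theta^c = S_b. *)
Definition theta p : 'cV[R]_m := - Jup i p *m \col_d S p d.

Lemma J_theta p : dom i p -> J i p *m theta p = \col_d S p d.
Proof. by move=> ip; rewrite mulmxA mulmxN J_Jup// opprK mul1mx. Qed.

Lemma smooth_at_Scol p : dom i p -> smooth_at (fun q => \col_d S q d) p.
Proof.
move=> ip; apply/smooth_at_mxP => u v.
under [X in smooth_at X]funext do rewrite mxE.
exact: smooth_at_schouten1.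
Qed.

Lemma smooth_at_theta p : dom i p -> smooth_at theta p.
Proof.
move=> ip; apply: smooth_mxM; last exact: smooth_at_Scol.
exact/smooth_mxN/smooth_at_Jup.
Qed.

Lemma curvXs_schouten1 p a b : dom i p -> curvXs i S p a b = (2 * J i p a b) *: theta p.
Proof.
move=> ip; apply: (can_inj (mulKmx (J_nondegenerate ip))).
apply/matrixP => d k; rewrite ord1 J_curvXs// -scalemxAr J_theta// curvrX_schouten1//.
by rewrite !mxE.
Qed.

Lemma cols2_delta_sum r (u v : 'cV[R]_r) (x y : R) :
  cols2 u v *m (x *: delta_mx 0 1 + y *: delta_mx 1 0) = cols2 (y *: v) (x *: u).
Proof.
apply/matrixP => c k; rewrite mxE big_ord_recl big_ord1.
have -> : lift ord0 ord0 = 1 :> 'I_2 by exact: val_inj.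
rewrite cols2E0 cols2E1.
have E (k' l : 'I_2) : (x *: delta_mx 0 1 + y *: delta_mx 1 0 : 'M[R]_2) k' l =
    x * ((k' == 0) && (l == 1))%:R + y * ((k' == 1) && (l == 0))%:R.
  by rewrite !mxE.
by rewrite !E; elim/ord2_ind: k; rewrite ?cols2E0 ?cols2E1 !mxE /=; ring.
Qed.

Lemma col_cols2 r (u v : 'cV[R]_r) : col 0 (cols2 u v) = u.
Proof. by apply/matrixP => c k; rewrite mxE cols2E0 ord1. Qed.

(** The covariant derivative of [theta], with the quadratic term that arises when the entry TM -> TM
    of the curvature, 2 J_ab [Lam], multiplies the entry s -> TM of D. *)
Definition dtheta p e : 'cV[R]_m :=
  dpart i e theta p + gam i p e *m theta p - Lam i p *m col e (Lam i p).

Let sS q c : dom i q -> smooth_at (S ^~ c) q.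
Proof. exact: smooth_at_schouten1. Qed.

Definition ur_col0 (A : 'M[R]_(m + 2)) : 'cV[R]_m := col 0 (ursubmx A).

Lemma bianchi_ur p e a b : dom i p ->
  ur_col0 (dpart i e (curv i (tract i S) a b) p
    + tract i S p e *m curv i (tract i S) a b p
    - curv i (tract i S) a b p *m tract i S p e) =
  (2 * dpart i e (fun q => J i q a b) p) *: theta p
  + (2 * J i p a b) *: dtheta p e + curvrs i S p a b *: delta_mx e 0.
Proof.
move=> ip; have sC : smooth_at (curv i (tract i S) a b) p.
  exact: smooth_at_curv_tract.
have urD (A B : 'M[R]_(m + 2)) : ur_col0 (A + B) = ur_col0 A + ur_col0 B.
  by apply/matrixP => u v; rewrite !mxE.
have urN (A : 'M[R]_(m + 2)) : ur_col0 (- A) = - ur_col0 A.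
  by apply/matrixP => u v; rewrite !mxE.
rewrite urD urN urD.
have -> : ur_col0 (dpart i e (curv i (tract i S) a b) p) =
    (2 * dpart i e (fun q => J i q a b) p) *: theta p +
    (2 * J i p a b) *: dpart i e theta p.
  rewrite /ur_col0 dpart_ursubmx// -(dpart_col e 0 ip); last exact: smooth_at_ursubmx.
  rewrite (@dpart_eq _ _ _ _ i e _ (fun q => (2 * J i q a b) *: theta q) p (dom i))//.
  - rewrite dpart_mxZ// ?dpart_2J//; first exact: smooth_at_2J.
    exact: smooth_at_theta.
  - exact: dom_open.
  - by move=> q iq; rewrite curv_tract// block_mxKur col_cols2 curvXs_schouten1.
rewrite /ur_col0 curv_tract// /tract !mulmx_block !block_mxKur curvXXL// curvXs_schouten1//.
rewrite mulmx_cols2 cols2_delta_sum mulmx_cols2 cols2_delta !add_cols2 !col_cols2.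
rewrite scaler0 addr0 -scalemxAr -scalemxAl /dtheta.
move: (theta p) (dpart i e theta p) (Lam i p *m _) (gam i p e *m _) => A B C D.
by apply/matrixP => u v; rewrite !mxE; ring.
Qed.

Lemma cyclic_ur p e a b c : dom i p ->
  2 * J i p a b * dtheta p e c 0 + (c == e)%:R * curvrs i S p a b +
  (2 * J i p b e * dtheta p a c 0 + (c == a)%:R * curvrs i S p b e) +
  (2 * J i p e a * dtheta p b c 0 + (c == b)%:R * curvrs i S p e a) = 0.
Proof.
move=> ip.
have urD (A B : 'M[R]_(m + 2)) : ur_col0 (A + B) = ur_col0 A + ur_col0 B.
  by apply/matrixP => u v; rewrite !mxE.
have ur3 (A B C : 'M[R]_(m + 2)) : A + B + C = 0 -> ur_col0 A + ur_col0 B + ur_col0 C = 0.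
  by move=> E; rewrite -!urD E; apply/matrixP => u v; rewrite !mxE.
have := ur3 _ _ _ (@second_bianchi _ _ M i _ (tract i S) e a b p ip (fun f =>
  smooth_at_tract ip (sS f ip))).
have E1 := bianchi_ur e a b ip; have E2 := bianchi_ur a b e ip.
have E3 := bianchi_ur b e a ip.
move=> /(etrans (esym (congr2 +%R (congr2 +%R E1 E2) E3))) /matrixP/(_ c 0).
have := cyclic_dJ e a b ip.
move: (dpart i e _ p) (dpart i a _ p) (dpart i b _ p) => x y z xyz.
have {xyz} -> : z = - x - y by rewrite -[RHS]add0r -xyz; ring.
move: (dtheta p e) (dtheta p a) (dtheta p b) (theta p) (curvrs i S p a b)
  (curvrs i S p b e) (curvrs i S p e a) (J i p a b) (J i p b e) (J i p e a)
   => D1 D2 D3 T u1 u2 u3 j1 j2 j3.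
by rewrite !mxE !eqxx !andbT => <-; ring.
Qed.

(** With its index lowered, [dtheta] is nabla_a S_b plus a term quadratic in Phi; antisymmetrising
    in a and b gives exactly [curvrs]. *)
Lemma J_dtheta p a b : dom i p ->
  (J i p *m dtheta p a) b 0 = dpart i a (S ^~ b) p - \sum_(c < m) gam i p a c b * S p c
    + (Rho i p *m Lam i p) b a.
Proof.
move=> ip; have sT := smooth_at_theta ip; have sJ := smooth_at_J ip.
have := dpart_eq a ip (dom_open i) ip (fun q iq => J_theta iq).
rewrite dpart_mxM// dpart_J// mulmxDl -!mulmxA J_theta// => /matrixP/(_ b 0) E.
rewrite [RHS]dpart_mxE in E; last 2 first.
- by [].
- exact: smooth_at_Scol.
have E1 : dpart i a (fun q => (\col_d S q d) b 0) p = dpart i a (S ^~ b) p.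
  by congr (dpart i a _ p); apply/funext => q; rewrite mxE.
rewrite {}E1 in E.
have -> : J i p *m dtheta p a = J i p *m dpart i a theta p
    + J i p *m (gam i p a *m theta p) + col a (Rho i p *m Lam i p).
  rewrite /dtheta mulmxBr mulmxDr; congr (_ + _).
  by rewrite mulmxA J_Lam// mulNmx opprK !colE mulmxA.
rewrite [LHS]mxE [X in _ + X]mxE; congr (_ + _).
move: E; rewrite [LHS]mxE [X in X + _]mxE => E.
rewrite [LHS]mxE -E.
have -> : ((gam i p a)^T *m \col_d S p d) b 0 = \sum_(c < m) gam i p a c b * S p c.
  by rewrite mxE; apply: eq_bigr => c _; rewrite !mxE.
by ring.
Qed.

Lemma curvrs_proportional p : dom i p ->
  exists u, forall a b, curvrs i S p a b = J i p a b * u.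
Proof.
(* Contracting c with e in [cyclic_ur] gives 2n [curvrs] = - 2 J_ab times the trace of [dtheta]: the
   skew part of J [dtheta] contributes 2 [curvrs], and two delta terms remove it again. *)
move=> ip; exists (- 2 / (2 * n)%:R * \sum_(e < m) dtheta p e e 0) => a b.
have H := big1 (op := +%R) (index_enum 'I_m) xpredT _
  (fun e _ => @cyclic_ur p e a b e ip).
rewrite !big_split /= -mulr_sumr !sum_delta in H.
have D f g : \sum_(e < m) J i p f e * dtheta p g e 0 = (J i p *m dtheta p g) f 0.
  by rewrite [RHS]mxE.
have E1 : \sum_(e < m) 2 * J i p b e * dtheta p a e 0 = 2 * (J i p *m dtheta p a) b 0.
  by under eq_bigr do rewrite -mulrA; rewrite -mulr_sumr D.
have E2 : \sum_(e < m) 2 * J i p e a * dtheta p b e 0 = - 2 * (J i p *m dtheta p b) a 0.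
  under eq_bigr do rewrite (J_skew_entry a _ ip) mulrN mulNr -mulrA.
  by rewrite sumrN -mulr_sumr D mulNr.
have E3 : \sum_(e < m) (e == e)%:R * curvrs i S p a b = (2 * n)%:R * curvrs i S p a b.
  under eq_bigr do rewrite eqxx mul1r.
  by rewrite sumr_const card_ord mulr_natl.
(* The index [a] witnesses n > 0. *)
have N0 : (2 * n)%:R != 0 :> R.
  by rewrite pnatr_eq0 -lt0n (leq_ltn_trans _ (ltn_ord a)).
have G : \sum_(c < m) gam i p a c b * S p c = \sum_(c < m) gam i p b c a * S p c.
  by apply: eq_bigr => c _; rewrite gam_sym.
rewrite {}E1 {}E2 {}E3 !J_dtheta// -{}G (curvrs_skew i S p a b) in H.
have U : curvrs i S p a b = dpart i a (S ^~ b) p - dpart i b (S ^~ a) p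
    - (Rho i p *m Lam i p) a b + (Rho i p *m Lam i p) b a.
  by rewrite /curvrs !row_mul_col.
apply: (mulfI N0); move: N0 H U.
move: (\sum_(c < m) gam i p a c b * S p c) => g.
move: (\sum_(e < m) dtheta p e e 0) (curvrs i S p a b) => x u.
move: ((_ *m _) a b) ((_ *m _) b a) (dpart i a _ _) (dpart i b _ _) (J i p a b) => rab rba da db j.
move: (2 * n)%:R => N N0 H U.
have -> : N * (j * (- 2 / N * x)) = - 2 * j * x by field.
by apply/eqP; rewrite -subr_eq0 -[X in _ == X]H U; apply/eqP; ring.
Qed.

End RicciType.

(** * Symplectic flatness *)

Section LocalSections.
Context {R : realType} {l : nat} (M : manifold R l) {r : nat} (E : vbundle M r).

(** The section constant in the frame [k]. It takes any prescribed value at [p], which allows an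
    identity on sections to be read as one on matrices. *)
Lemma local_section (k : triv E) p v : is_vbundle E -> vdom k p ->
  exists S, is_section (vdom k) S /\ S k p = v.
Proof.
move=> [oE _ sE E1 EE] kp; exists (fun k' q => trans k k' q *m v); split; last first.
  by rewrite E1// mul1mx.
split=> [k'|k1 k2 q kq k1q k2q]; last by rewrite mulmxA -EE.
apply: csmoothP => q [kq k'q]; apply: smooth_mxM; last exact: smooth_at_cst.
by apply: csmooth_at (sE k k') _ => //; exact: openI.
Qed.

Lemma section_smooth_at (W : set M) S (k : triv E) p : is_vbundle E ->
  open W -> is_section W S -> W p -> vdom k p -> smooth_at (S k) p.
Proof.
move=> [oE _ _ _ _] oW [sS _] Wp kp; apply: csmooth_at (sS k) _ => //.
by apply: openI.
Qed.

End LocalSections.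

Lemma eq_mx_mulV (R : pzRingType) r s (A B : 'M[R]_(r, s)) :
  (forall v : 'cV_s, A *m v = B *m v) -> A = B.
Proof.
move=> AB; apply/matrixP => u w.
by have /matrixP/(_ u 0) := AB (delta_mx w 0); rewrite -!colE !mxE.
Qed.

Lemma congruence_entry (R : comPzRingType) r (H A : 'M[R]_r) (x : R) (a b : 'I_r) :
  \sum_c \sum_d H c a * H d b * (x * A c d) = x * (H^T *m A *m H) a b.
Proof.
rewrite mxE mulr_sumr exchange_big; apply: eq_bigr => d _.
rewrite mxE mulr_suml mulr_sumr; apply: eq_bigr => c _.
by rewrite mxE; ring.
Qed.

Section Main.
Context {R : realType} {n : nat} (M : symplectic R n).
Notation m := (2 * n)%N.
Implicit Types (p q : M) (i k : chart M) (a b c d e : 'I_m).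

Let F i a b p := curv i (tract i (schouten1 i)) a b p.

Lemma curv_tractor_conn i k a b p : dom i p -> dom k p ->
  curv i (@tractor_conn _ _ M k i) a b p =
  \sum_c \sum_d (jac (id : M -> M) i k p c a * jac (id : M -> M) i k p d b)
    *: F k c d p.
Proof.
move=> ip kp.
apply: (curv_pullback (smooth_map_id M) (B := tract k (schouten1 k)) a b ip kp).
by move=> c; apply: smooth_at_tract => //; exact: smooth_at_schouten1.
Qed.

Lemma curv_tractor_conn_own i a b p : dom i p ->
  curv i (@tractor_conn _ _ M i i) a b p = F i a b p.
Proof.
move=> ip; apply: (curv_eq a b ip (dom_open i) ip) => q iq.
apply/funext => c; rewrite /tractor_conn jac_id//.
rewrite (bigD1 c)//= big1 ?addr0 => [|d dc]; first by rewrite mxE eqxx scale1r.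
by rewrite mxE (negPf dc) scale0r.
Qed.

Lemma nabla_christoffel_sym i p a b c : dom i p ->
  christoffel (@nabla _ n M) i p a b c = christoffel (@nabla _ n M) i p b a c.
Proof. exact: nabla_torsion_free. Qed.

Lemma tractor_commutatorE W S k i a b p : open W ->
  is_section (E := tractor M) W S -> W p -> dom k p -> dom i p ->
  commutator (@nabla _ n M) (@tractor_conn _ _ M) S k i a b p =
  curv i (@tractor_conn _ _ M k i) a b p *m S k p.
Proof.
move=> oW sS Wp kp ip; apply: commutatorE => //.
- by move=> c; exact: nabla_christoffel_sym.
- exact: (section_smooth_at (tractor_is_vbundle M) oW sS Wp kp).
- by move=> c; exact: smooth_at_tractor_conn.
Qed.

Lemma nabla_commutatorE W X i a b p : open W ->
  is_section (E := tangent M) W X -> W p -> dom i p ->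
  commutator (E := tangent M) (@nabla _ n M) (@nabla _ n M) X i i a b p =
  curv i (gam i) a b p *m X i p.
Proof.
move=> oW sX Wp ip; apply: commutatorE => //.
- by move=> c; exact: nabla_christoffel_sym.
- exact: (section_smooth_at (tangent_is_vbundle M) oW sX Wp ip).
- by move=> c; exact: smooth_at_gam.
Qed.

Lemma is_curvatureP (Rm : chart M -> M -> 'I_m -> 'I_m -> 'I_m -> 'I_m -> R) :
  is_curvature Rm <->
  forall i p, dom i p -> forall a b c d, curv i (gam i) a b p c d = Rm i p a b c d.
Proof.
split=> [H i p ip a b c d|H W X oW sX i a b c p Wp ip].
  have [X [sX XE]] := @local_section _ _ M _ (tangent M) i p (delta_mx d 0)
    (tangent_is_vbundle M) ip.
  have := H _ X (dom_open i) sX i a b c p ip ip.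
  rewrite (nabla_commutatorE a b (dom_open i) sX ip ip) XE -colE mxE => ->.
  rewrite (bigD1 d)//= big1 ?addr0 => [|e ed]; first by rewrite !mxE !eqxx mulr1.
  by rewrite !mxE (negPf ed) mulr0.
rewrite (nabla_commutatorE a b oW sX Wp ip) mxE.
by apply: eq_bigr => d _; rewrite H.
Qed.

Lemma flat_proportional : symplectically_flat (@tractor_conn _ _ M) ->
  forall i p, dom i p -> exists K, forall a b, F i a b p = J i p a b *: K.
Proof.
move=> [Th [_ H]] i p ip; exists (2 *: Th i p) => a b.
rewrite -curv_tractor_conn_own//; apply: eq_mx_mulV => v.
have [S [sS SE]] := @local_section _ _ M _ (tractor M) i p v
  (tractor_is_vbundle M) ip.
have := H _ S (dom_open i) sS i i a b p ip ip ip.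
rewrite (tractor_commutatorE a b (dom_open i) sS ip ip ip) SE => ->.
by rewrite -!scalemxAl scalerA mulrC.
Qed.

Lemma sum_J_Jup i p : dom i p -> \sum_a \sum_b J i p a b * Jup i p a b = (2 * n)%:R.
Proof.
move=> ip; rewrite exchange_big.
transitivity (\tr ((J i p)^T *m Jup i p)).
  apply: eq_bigr => b _; rewrite mxE; apply: eq_bigr => a _.
  by rewrite [X in _ = X * _]mxE.
by rewrite mulmxV ?mxtrace1// unitmx_tr J_nondegenerate.
Qed.

(* Theta is 1/(4n) J^ab F_ab, which is smooth and transforms correctly without
   any choice. *)
Lemma proportional_flat :
  (forall i p, dom i p -> exists K, forall a b, F i a b p = J i p a b *: K) ->
  symplectically_flat (@tractor_conn _ _ M).
Proof.
move=> H.
pose Theta k p : 'M[R]_(m + 2) :=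
  (2 * (2 * n)%:R)^-1 *: \sum_a \sum_b Jup k p a b *: F k a b p.
have FE i p a b : dom i p -> F i a b p = (2 * J i p a b) *: Theta i p.
  move=> ip; have [K KE] := H i p ip.
  have -> : Theta i p = 2^-1 *: K.
    rewrite /Theta; under eq_bigr do under eq_bigr do rewrite KE scalerA mulrC.
    under eq_bigr do rewrite -scaler_suml.
    rewrite -scaler_suml sum_J_Jup// scalerA invfM mulrC; congr (_ *: _).
    rewrite mulrCA mulfV ?mulr1//.
    by rewrite pnatr_eq0 -lt0n (leq_ltn_trans _ (ltn_ord a)).
  by rewrite KE scalerA mulrAC mulfV ?mul1r// pnatr_eq0.
exists Theta; split; last first.
  move=> W S oW sS k i a b p Wp kp ip.
  rewrite (tractor_commutatorE a b oW sS Wp kp ip) scalemxAl; congr (_ *m _).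
  rewrite curv_tractor_conn//.
  under eq_bigr do under eq_bigr do rewrite FE// scalerA.
  under eq_bigr do rewrite -scaler_suml.
  rewrite -scaler_suml; congr (_ *: _).
  by rewrite congruence_entry -(J_tensor M).2.
split=> [k|k l p kp lp].
  apply: csmoothP => p kp; apply: smooth_mxZ; first exact: smooth_at_cst.
  apply: smooth_mx_sum => a _; apply: smooth_mx_sum => b _; apply: smooth_mxZ.
    exact/smooth_at_coord/smooth_at_Jup.
  apply: smooth_at_curv => // c; apply: smooth_at_tract => //.
  exact: smooth_at_schouten1.
have idM := smooth_map_id M; have idm := id_morphism M.
pose H1 := jac (id : M -> M) k l p; pose h := extend_mx H1.
have sA i c : dom i p -> smooth_at (fun q => tract i (schouten1 i) q c) p.
  by move=> ip; apply: smooth_at_tract => //; exact: smooth_at_schouten1.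
have E a b : (\sum_c \sum_d (H1 c a * H1 d b) *: F l c d p) *m h = h *m F k a b p.
  apply: (@curv_natural _ _ _ _ _ _ idM k l _ _ (tract k (schouten1 k))
    (tract l (schouten1 l)) (fun q => extend_mx (jac (id : M -> M) k l q)) a b p
    (dom k `&` dom l) kp lp) => //.
  - by apply: openI; exact: dom_open.
  - exact/smooth_at_extend/(smooth_at_jac idM).
  - by move=> c; exact: sA.
  - by move=> c; exact: sA.
  - move=> q c [kq lq]; apply: (tract_natural idm kq lq).
    exact: (schouten1_natural idm).
(* Covariance of the curvature and of J only yields J_ab [X] = 0 for all a and b; contraction with
   J^ab turns this into 2n [X] = 0. *)
pose X := Theta l p *m h - h *m Theta k p.
have X0 a b : J k p a b *: X = 0.
  have := E a b; rewrite (FE k)// -scalemxAr => /eqP.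
  under eq_bigr do under eq_bigr do rewrite FE// scalerA.
  under eq_bigr do rewrite -scaler_suml.
  rewrite -scaler_suml -scalemxAl.
  have -> : \sum_(c < m) \sum_(d < m) H1 c a * H1 d b * (2 * J l p c d) = 2 * J k p a b.
    by rewrite congruence_entry -(J_tensor M).2.
  rewrite -subr_eq0 -scalerBr -/X -scalerA scaler_eq0 pnatr_eq0 /=.
  by move/eqP.
have {X0} X0 : (2 * n)%:R *: X = 0.
  rewrite -(sum_J_Jup kp) scaler_suml big1// => a _; rewrite scaler_suml big1// => b _.
  by rewrite mulrC -scalerA X0 scaler0.
apply/eqP; rewrite -subr_eq0 -[_ - _]/X; move/eqP: X0; rewrite scaler_eq0.
case/orP => // /eqP n0.
(* If n = 0, then Theta vanishes because of the convention 0^-1 = 0. *)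
have T0 k' q : Theta k' q = 0.
  rewrite /Theta (_ : (2 * (2 * n)%:R)^-1 = 0 :> R) ?scale0r//.
  by apply/eqP; rewrite invr_eq0 mulf_eq0 orbC; apply/orP; left; apply/eqP.
by rewrite /X !T0 mul0mx mulmx0 subrr.
Qed.

Lemma tractor_flatP :
  symplectically_flat (@tractor_conn _ _ M) <->
  exists Phi : chart M -> M -> 'M[R]_m,
    is_symmetric_tensor Phi /\ is_curvature (curvature_form Phi).
Proof.
split=> [/flat_proportional H|[Phi [[_ Psym] /is_curvatureP HP]]].
  exists (@Rho _ _ M); split; first split; first split.
  - by move=> i; apply: csmoothP => p ip; exact: smooth_at_Rho.
  - by move=> i j p ip jp; exact: (Rho_natural (id_morphism M)).
  - by move=> i p ip; exact: Rho_sym.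
  - apply/is_curvatureP => i p ip a b; apply/curvXX_curvature_form => //.
    have [K KE] := H i p ip.
    apply: (@curvXX_proportional _ _ _ _ _ (ulsubmx K)) => // a' b'.
    have := KE a' b'; rewrite /F curv_tract//; last first.
      by move=> *; exact: smooth_at_schouten1.
    move=> /(congr1 (@ulsubmx _ m 2 m 2)); rewrite block_mxKul => ->.
    by apply/matrixP => u v; rewrite !mxE.
apply: proportional_flat => i p ip.
(* D is built from [Rho] and not from the given [Phi]; the trace shows that the two agree. *)
have curvXXL q a b : dom i q -> curvXX i q a b = (2 * J i q a b) *: Lam i q.
  move=> iq; apply/(curvXX_curvature_form a b iq) => c d.
  rewrite HP//; have PE := curvature_form_Rho iq (Psym _ _ iq) (HP _ _ iq).
  by rewrite /curvature_form PE.
have [u uE] := curvrs_proportional curvXXL ip.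
(* The endomorphism whose product with J_ab is the curvature. The factors 2 come from the
   proportional entries, the 2 at [delta_mx 0 1] from the constant entry r -> s, and [u] from the
   entry s -> r. *)
exists (block_mx (2 *: Lam i p) (cols2 (2 *: theta i p) 0)
  (rows2 0 (2 *: \row_d schouten1 i p d)) (2 *: delta_mx 0 1 + u *: delta_mx 1 0)).
move=> a b; rewrite /F curv_tract//; last by move=> *; exact: smooth_at_schouten1.
rewrite curvXXL// curvXs_schouten1// uE scale_block_mx scale_cols2 scale_rows2 !scaler0.
rewrite scalerDr !scalerA ![J i p a b * _]mulrC; congr block_mx; congr rows2.
by apply/matrixP => v d; rewrite ord1 curvrX_schouten1// !mxE; ring.
Qed.

End Main.

Theorem theorem2 (R : realType) (n : nat) :
  exists (T : forall M : symplectic R n, vbundle M (2 * n + 2))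
         (A : forall M : symplectic R n, conn_form (T M)),
    natural A /\
    forall M : symplectic R n,
      symplectically_flat (A M) <->
      exists Phi : chart M -> M -> 'M[R]_(2 * n),
        is_symmetric_tensor Phi /\ is_curvature (curvature_form Phi).
Proof.
exists (@tractor R n), (@tractor_conn R n).
by split=> [|M]; [exact: tractor_natural|exact: tractor_flatP].
Qed.
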